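(* Suppose that $G=G_1*_{G_0} G_2$ is an amalgamated free product, where $G_0$ is virtually cyclic and $G_0$ is a virtual retract of $G_i$, for $i=1,2$. \begin{itemize} \item[(i)] If $G_1$, $G_2$ are residually finite then so is $G$. \item[(ii)] If $G_1$, $G_2$ are virtually residually solvable then so is $G$. \end{itemize}
   Context: A subgroup $H$ of a group $G$ is a virtual retract of $G$ if there are a finite index subgroup $K\leqslant G$ containing $H$ and a homomorphism $\rho:K\to H$ with $\rho|_H=\mathrm{Id}_H$. A group is residually solvable if every non-trivial element has non-trivial image in some solvable quotient of the group; it is virtually residually solvable if it has a finite index residually solvable subgroup. A group is virtually cyclic if it has a cyclic subgroup of finite index (finite groups are included). *)

(* Defs.v *)
From HB Require Import structures.
From mathcomp Require Import all_boot.
From mathcomp Require Import boolp classical_sets cardinality.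

Set Implicit Arguments.
Unset Strict Implicit.
Unset Printing Implicit Defensive.

Local Open Scope classical_set_scope.
Local Open Scope group_scope.

Notation "{ 'hom' G -> H }" := (UMagmaMorphism.type G H)
  (at level 0, G at level 98, H at level 99,
   format "{ 'hom'  G  ->  H }") : type_scope.

(* A subgroup of a (possibly infinite) group G is a term of type groupClosed G;
   subgroup K is the same subgroup seen as a group in its own right. *)
Section Subgroup.
Variables (G : groupType) (K : groupClosed G).

Record subgroup := Subgroup { sgval : G; sgvalP : sgval \in K }.

Let subgroup_closed : group_closed [pred x | x \in K].
Proof. by split=> [|x y]; rewrite ?inE /=; [exact: gpred1 | exact: gpredF]. Qed.

HB.instance Definition _ := [isSub for sgval].
HB.instance Definition _ := [Choice of subgroup by <:].
HB.instance Definition _ :=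
  SubChoice_isSubGroup.Build G _ subgroup subgroup_closed.
End Subgroup.

Section Image.
Variables (G H : groupType) (f : {hom G -> H}).

Definition image_pred : {pred H} := fun y => `[< exists x, f x = y >].

Let image_invg : invg_closed image_pred.
Proof. by move=> _ /asboolP[x <-]; apply/asboolP; exists x^-1; rewrite gmulfV. Qed.

Let image_1 : 1 \in image_pred.
Proof. by apply/asboolP; exists 1; rewrite gmulf1. Qed.

Let image_mulg : mulg_closed image_pred.
Proof.
move=> _ _ /asboolP[x <-] /asboolP[y <-]; apply/asboolP.
by exists (x * y); rewrite gmulfM.
Qed.

Definition group_image : groupClosed H :=
  HB.pack_for (groupClosed H) image_pred
    (isInvClosed.Build H image_pred image_invg)
    (isMul1Closed.Build H image_pred image_1)
    (isMulClosed.Build H image_pred image_mulg).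
End Image.

Definition left_coset (G : groupType) (K : groupClosed G) (x : G) : set G :=
  [set x * k | k in [set k | k \in K]].

Definition finite_index (G : groupType) (K : groupClosed G) : Prop :=
  finite_set (range (left_coset K)).

Definition cyclic_subgroup (G : groupType) (K : groupClosed G) : Prop :=
  exists g : G, forall x : G,
    x \in K <-> exists n : nat, x = g ^+ n \/ x = g ^- n.

Definition virtually_cyclic (G : groupType) : Prop :=
  exists K : groupClosed G, cyclic_subgroup K /\ finite_index K.

Definition virtual_retract (G : groupType) (H : groupClosed G) : Prop :=
  exists K : groupClosed G,
    [/\ finite_index K, {subset H <= K} &
        exists rho : {hom subgroup K -> subgroup H},
          forall x : subgroup K, sgval x \in H -> sgval (rho x) = sgval x].

Definition generated (G : groupType) (A : set G) : set G :=
  [set x | forall K : groupClosed G, (forall a, A a -> a \in K) -> x \in K].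

Fixpoint derived_series (G : groupType) (n : nat) : set G :=
  if n is m.+1 then
    generated [set z | exists x y, [/\ @derived_series G m x,
                                       @derived_series G m y & z = [~ x, y]]]
  else setT.
Arguments derived_series : clear implicits.

Definition solvable_group (G : groupType) : Prop :=
  exists n : nat, derived_series G n = [set 1].

Definition finite_group (G : groupType) : Prop := finite_set [set: G].

Definition residually (P : groupType -> Prop) (G : groupType) : Prop :=
  forall g : G, g <> 1 ->
    exists (Q : groupType) (q : {hom G -> Q}),
      [/\ P Q, forall y, exists x, q x = y & q g <> 1].

Definition residually_finite : groupType -> Prop := residually finite_group.

Definition residually_solvable : groupType -> Prop :=
  residually solvable_group.

Definition virtually_residually_solvable (G : groupType) : Prop :=
  exists K : groupClosed G,
    finite_index K /\ residually_solvable (subgroup K).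

(* The amalgamated free product G1 *_{G0} G2 is only determined up to
   isomorphism: G, with j1 and j2, is one when it is the pushout of the
   embeddings i1 and i2 in the category of groups. Injectivity of j1 and j2 is
   a theorem, not part of the definition. *)
Definition is_amalgamated_product (G0 G1 G2 G : groupType)
    (i1 : {hom G0 -> G1}) (i2 : {hom G0 -> G2})
    (j1 : {hom G1 -> G}) (j2 : {hom G2 -> G}) : Prop :=
  [/\ injective i1, injective i2, j1 \o i1 =1 j2 \o i2 &
      forall (H : groupType)
        (f1 : {hom G1 -> H}) (f2 : {hom G2 -> H}),
        f1 \o i1 =1 f2 \o i2 ->
        exists f : {hom G -> H},
          [/\ f \o j1 =1 f1, f \o j2 =1 f2 &
              forall f' : {hom G -> H},
                f' \o j1 =1 f1 -> f' \o j2 =1 f2 -> f' =1 f]].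

(* Main.v *)
(* Let E be the image of G0 in G.

   If f : G -> H separates the syllables of a reduced word from E, then the graph
   of cosets in H of the images of the two factors has a cover with group
   (Z/2)^H, on which G acts through the wreath product of Z/2 and H, and in which
   the shortest closed reduced paths of the graph are no longer closed. Iterating
   this, every reduced word survives in an iterated extension of H with kernels
   of exponent 2, which is finite if H is, and solvable on a subgroup N if f is.
   So only the elements of E and those of G1 and G2 outside E need be detected.

   Let <c> be a cyclic subgroup of finite index of G0, with c of infinite order
   or trivial. The retractions cut out normal subgroups N1, N2 of finite index in
   G1, G2, inside any prescribed ones, with the same trace <c^b> on G0. Then G1
   and G2 act on G1/N1 x G2/N2 compatibly on G0, which gives (i).

   For (ii), combining the conjugates of the logarithm of the retraction with
   independent coefficients yields homomorphisms phi_i from N_i to a field k with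
   phi_i(v^-1 c^b v) <> 0 for all v in G_i. Induce phi_i to G_i and rescale the
   coordinates by these values: c^b then acts as x |-> x + 1 on every coordinate,
   whichever the factor, so G maps to Aff(k) wr H with H finite, injectively on
   G0. An element of G1 killed by this map lies in the residually solvable
   subgroup, and is detected by inducing one more quotient, trivial on G0. *)

From HB Require Import structures.
Require Import Defs.
From mathcomp Require Import all_boot all_algebra fraction zify ring.
From mathcomp Require Import boolp classical_sets functions cardinality.

Set Implicit Arguments.
Unset Strict Implicit.
Unset Printing Implicit Defensive.

Import GRing.Theory Num.Theory.
Local Open Scope classical_set_scope.
Local Open Scope group_scope.

(** * Permutation groups and wreath products *)

Section Hom.
Variables (G H : groupType) (f : G -> H).
Hypothesis fM : {morph f : x y / x * y}.

Let f1 : f 1 = 1.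
Proof. by apply: (@mulgI _ (f 1)); rewrite -fM !mulg1. Qed.

Definition mkhom : {hom G -> H} :=
  HB.pack_for {hom G -> H} f
    (isUMagmaMorphism.Build G H f (f1, fM)).

Lemma mkhomE x : mkhom x = f x. Proof. by []. Qed.
End Hom.

Section Sub.
Variables (G : groupType) (A : set G).
Hypotheses (A1 : A 1) (AF : forall x y, A x -> A y -> A (x / y)).

Let p : {pred G} := fun x => `[< A x >].

Let pV : invg_closed p.
Proof. by move=> x /asboolP Ax; apply/asboolP; rewrite -div1g; exact: AF. Qed.

Let pM : mulg_closed p.
Proof.
move=> x y px /pV py; apply/asboolP; rewrite -[y]invgK.
by apply: AF; exact/asboolP.
Qed.

Definition mksub : groupClosed G :=
  HB.pack_for (groupClosed G) p
    (isInvClosed.Build G p pV)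
    (isMul1Closed.Build G p (introT (asboolP _) A1))
    (isMulClosed.Build G p pM).

Lemma mksubP x : x \in mksub <-> A x.
Proof. by split=> [/asboolP|/asboolP]. Qed.
End Sub.

(** The inverse is stored as data, so that inversion in the group swaps the two maps; it is
    determined by the forward map, on which equality can therefore be tested. *)
Record bij (T : Type) := Bij {
  bijf :> T -> T; bijv : T -> T;
  bijfK : cancel bijf bijv; bijvK : cancel bijv bijf }.

HB.instance Definition _ (T : Type) := gen_eqMixin (bij T).
HB.instance Definition _ (T : Type) := gen_choiceMixin (bij T).

Lemma bij_eq T (f g : bij T) : f =1 g -> f = g.
Proof.
case: f g => [f f' fK f'K] [g g' gK g'K] /= /funext fg; subst g.
have fg' : f' = g' by apply/funext => x; rewrite -[x in LHS]g'K fK.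
by subst g'; congr Bij; exact: Prop_irrelevance.
Qed.

Section BijGroup.
Variable T : Type.
Definition bij_one : bij T := @Bij T id id (fun=> erefl) (fun=> erefl).
Definition bij_inv (f : bij T) : bij T := Bij (@bijvK _ f) (@bijfK _ f).
Definition bij_mul (f g : bij T) : bij T :=
  Bij (can_comp (@bijfK _ f) (@bijfK _ g)) (can_comp (@bijvK _ g) (@bijvK _ f)).

Lemma bij_mulA : associative bij_mul. Proof. by move=> *; exact: bij_eq. Qed.
Lemma bij_mul1g : left_id bij_one bij_mul. Proof. by move=> *; exact: bij_eq. Qed.
Lemma bij_mulg1 : right_id bij_one bij_mul. Proof. by move=> *; exact: bij_eq. Qed.
Lemma bij_mulVg : left_inverse bij_one bij_inv bij_mul.
Proof. by move=> f; apply: bij_eq => x /=; rewrite bijfK. Qed.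
Lemma bij_mulgV : right_inverse bij_one bij_inv bij_mul.
Proof. by move=> f; apply: bij_eq => x /=; rewrite bijvK. Qed.

HB.instance Definition _ := isGroup.Build (bij T)
  bij_mulA bij_mul1g bij_mulg1 bij_mulVg bij_mulgV.

Lemma bijM (f g : bij T) x : (f * g) x = f (g x). Proof. by []. Qed.
Lemma bijV (f : bij T) : bijf f^-1 = bijv f. Proof. by []. Qed.
End BijGroup.

(** The unrestricted regular wreath product: all functions on [H] are allowed, and [H] acts on them
    by left translation. *)
Definition wreath (P H : groupType) : Type := ((H -> P) * H)%type.

Section WreathGroup.
Variables P H : groupType.
HB.instance Definition _ := Choice.copy (wreath P H) ((H -> P) * H)%type.
Implicit Types a b : wreath P H.
Definition wr_one : wreath P H := (fun=> 1, 1).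
Definition wr_mul a b : wreath P H :=
  (fun y => a.1 y * b.1 (a.2^-1 * y), a.2 * b.2).
Definition wr_inv a : wreath P H := (fun y => (a.1 (a.2 * y))^-1, a.2^-1).

Lemma wr_mulA : associative wr_mul.
Proof.
move=> a b c; rewrite /wr_mul /=; congr pair; last by rewrite mulgA.
by apply/funext=> y /=; rewrite invgM -!mulgA.
Qed.
Lemma wr_mul1g : left_id wr_one wr_mul.
Proof.
move=> [f a]; rewrite /wr_mul /=; congr pair; last by rewrite mul1g.
by apply/funext=> y /=; rewrite invg1 !mul1g.
Qed.
Lemma wr_mulg1 : right_id wr_one wr_mul.
Proof.
move=> [f a]; rewrite /wr_mul /=; congr pair; last by rewrite mulg1.
by apply/funext=> y /=; rewrite mulg1.
Qed.
Lemma wr_mulVg : left_inverse wr_one wr_inv wr_mul.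
Proof.
move=> [f a]; rewrite /wr_mul /=; congr pair; last by rewrite mulVg.
by apply/funext=> y /=; rewrite invgK mulVg.
Qed.
Lemma wr_mulgV : right_inverse wr_one wr_inv wr_mul.
Proof.
move=> [f a]; rewrite /wr_mul /=; congr pair; last by rewrite mulgV.
by apply/funext=> y /=; rewrite mulVKg mulgV.
Qed.

HB.instance Definition _ := isGroup.Build (wreath P H)
  wr_mulA wr_mul1g wr_mulg1 wr_mulVg wr_mulgV.

Lemma wreath_mul1 a b y : (a * b).1 y = a.1 y * b.1 (a.2^-1 * y).
Proof. by []. Qed.
Lemma wreath_mul2 a b : (a * b).2 = a.2 * b.2. Proof. by []. Qed.
End WreathGroup.

(** * Finite index and coset actions *)

Definition finite_type (T : Type) : Prop :=
  exists (F : finType) (f : T -> F), injective f.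

Lemma finite_type_inj (S T : Type) (f : S -> T) :
  injective f -> finite_type T -> finite_type S.
Proof. by move=> fI [F [g gI]]; exists F, (g \o f); exact: inj_comp. Qed.

Lemma finite_type_fin (F : finType) : finite_type F.
Proof. by exists F, id. Qed.

Lemma finite_type_prod (S T : Type) :
  finite_type S -> finite_type T -> finite_type (S * T).
Proof.
move=> [F [f fI]] [F' [f' f'I]]; exists (F * F')%type, (fun p => (f p.1, f' p.2)).
by move=> [x y] [x' y'] /= [/fI-> /f'I->].
Qed.

Lemma finite_type_fun (S T : Type) :
  finite_type S -> finite_type T -> finite_type (S -> T).
Proof.
move=> [F [f fI]] [F' [f' f'I]].
have /choice[g gP] (i : F) : exists h : option S,
    forall x, f x = i -> h = Some x.
  have [[x <-]|nex] := pselect (exists x, f x = i).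
    by exists (Some x) => y /fI->.
  by exists None => x fx; case: nex; exists x.
exists {ffun F -> option F'},
  (fun h => [ffun i => omap (fun x => f' (h x)) (g i)]).
move=> h h' /ffunP hh'; apply/funext=> x; apply: f'I.
by have := hh' (f x); rewrite !ffunE (gP _ x erefl) /= => -[].
Qed.

Lemma finite_typeP (T : choiceType) : finite_set [set: T] <-> finite_type T.
Proof.
split=> [/finite_seqP[s sT]|[F [f fI]]].
  have ins x : x \in s.
    have : [set: T] x by [].
    by rewrite sT.
  exists 'I_(size s),
    (fun x => Ordinal (etrans (index_mem x s) (ins x))).
  by move=> x y [] /(congr1 (nth x s)); rewrite !nth_index.
have -> : [set: T] = f @^-1` [set: F] by [].
apply: finite_preimage; first by move=> x y _ _ /fI.
exact: finite_finset.
Qed.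

Lemma finite_type_bij T : finite_type T -> finite_type (bij T).
Proof.
move=> fT; apply: (@finite_type_inj _ (T -> T) (@bijf T)).
  by move=> f g fg; apply: bij_eq => x; rewrite fg.
exact: finite_type_fun.
Qed.

Lemma finite_type_wreath (P H : groupType) :
  finite_type P -> finite_type H -> finite_type (wreath P H).
Proof. by move=> fP fH; do !apply: finite_type_prod => //; exact: finite_type_fun. Qed.

Section Representative.
Variables (G : groupType) (K : groupClosed G).

(** The predicate passed to [choose] depends only on the left coset of [x], hence so does the chosen
    representative. *)
Definition lrep (x : G) : G := choose (fun y => x^-1 * y \in K) x.

Lemma lrepP x : x^-1 * lrep x \in K.
Proof. by apply: (@chooseP _ (fun y => x^-1 * y \in K)); rewrite mulVg gpred1. Qed.

Lemma lrep_eq x y : x^-1 * y \in K -> lrep x = lrep y.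
Proof.
move=> xy; rewrite /lrep.
have eqp : (fun z => x^-1 * z \in K) =1 (fun z => y^-1 * z \in K).
  by move=> z /=; rewrite -[in LHS](mulVKg y z) mulgA gpredMl.
rewrite (eq_choose eqp); apply: (@choose_id _ (fun z => y^-1 * z \in K)).
  by rewrite -gpredV invgM invgK.
by rewrite mulVg gpred1.
Qed.

Lemma eq_lrep x y : lrep x = lrep y -> x^-1 * y \in K.
Proof.
move=> xy; have := lrepP y; rewrite -xy -gpredV invgM invgK => yK.
have -> : x^-1 * y = x^-1 * lrep x * ((lrep x)^-1 * y) by rewrite mulgA mulgK.
by rewrite gpredM// lrepP.
Qed.

Lemma lrepK x : lrep (lrep x) = lrep x.
Proof. by apply/esym/lrep_eq/lrepP. Qed.
End Representative.

(** The map [r] separates cosets but may take several values on one coset, which makes such maps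
    easy to combine. *)
Definition fin_index (G : groupType) (K : groupClosed G) : Prop :=
  exists (F : finType) (r : G -> F), forall x y, r x = r y -> x^-1 * y \in K.

Lemma left_coset_eq (G : groupType) (K : groupClosed G) x y :
  left_coset K x = left_coset K y <-> x^-1 * y \in K.
Proof.
split=> [xy|xy].
  have : left_coset K y y by exists 1; rewrite ?mulg1 //=; exact: gpred1.
  by rewrite -xy => -[k kK <-]; rewrite mulKg.
apply/seteqP; split=> _ [k kK <-].
  exists (y^-1 * x * k); last by rewrite mulgA mulVKg.
  by rewrite /= gpredM// -gpredV invgM invgK.
exists (x^-1 * y * k); last by rewrite mulgA mulVKg.
by rewrite /= gpredM.
Qed.

Lemma finite_indexP (G : groupType) (K : groupClosed G) :
  finite_index K <-> fin_index K.
Proof.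
split=> [/finite_seqP[s sE]|[F [r rP]]].
  have ins x : left_coset K x \in s.
    have : range (left_coset K) (left_coset K x) by exists x.
    by rewrite sE.
  exists 'I_(size s),
    (fun x => Ordinal (etrans (index_mem (left_coset K x) s) (ins x))).
  move=> x y [] /(congr1 (nth set0 s)); rewrite !nth_index// => xy.
  exact/left_coset_eq.
have /choice[g gP] (i : F) : exists A, forall x, r x = i -> left_coset K x = A.
  have [[x xi]|nex] := pselect (exists x, r x = i).
    by exists (left_coset K x) => y yi; apply/left_coset_eq/rP; rewrite xi yi.
  by exists set0 => x xi; case: nex; exists x.
apply: (@sub_finite_set _ _ (g @` [set: F])).
  by move=> _ [x _ <-]; exists (r x) => //; rewrite -(gP _ x erefl).
apply: finite_image; exact: finite_finset.
Qed.

Section FinIndex.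
Variable G : groupType.
Implicit Types K L : groupClosed G.

(** An element is recorded by its coset of [K] and by the value of [r] on its quotient by the chosen
    representative; the latter cancels when two elements are compared. *)
Lemma fin_index_trans K L (F : finType) (r : G -> F) : fin_index K ->
  {in K &, forall x y, r x = r y -> x^-1 * y \in L} -> fin_index L.
Proof.
move=> [F' [r' r'P]] rP.
have tK x : (lrep K x)^-1 * x \in K.
  by rewrite -gpredV invgM invgK lrepP.
exists (F' * F)%type, (fun x => (r' x, r ((lrep K x)^-1 * x))) => x y [r'xy].
rewrite (lrep_eq (r'P _ _ r'xy)) => rxy.
have := rP ((lrep K y)^-1 * x) ((lrep K y)^-1 * y) _ _ rxy.
rewrite invgM invgK -mulgA mulVKg; apply; last exact: tK.
by rewrite -(lrep_eq (r'P _ _ r'xy)) tK.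
Qed.

Lemma fin_index_ker K (H : groupType) (f : {hom G -> H}) :
  finite_type H -> (forall x, f x = 1 -> x \in K) -> fin_index K.
Proof.
move=> [F [g gI]] fK; exists F, (g \o f) => x y /= /gI fxy.
by apply: fK; rewrite gmulfM gmulfV fxy mulVg.
Qed.
End FinIndex.

Section CosetAction.
Variables (G : groupType) (K : groupClosed G).

Definition coset_type := {x : G | lrep K x == x}.

Definition coset_of (x : G) : coset_type := exist _ (lrep K x) (introT eqP (lrepK K x)).

Lemma coset_of_eq x y : coset_of x = coset_of y <-> x^-1 * y \in K.
Proof.
split=> [/(congr1 val)/=/eq_lrep //|xy].
exact/val_inj/lrep_eq.
Qed.

Lemma coset_of_val (a : coset_type) : coset_of (val a) = a.
Proof. by apply/val_inj => /=; exact/eqP/(valP a). Qed.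

Definition coset_mul (g : G) (a : coset_type) := coset_of (g * val a).

Lemma coset_mulE g x : coset_mul g (coset_of x) = coset_of (g * x).
Proof.
apply/coset_of_eq; rewrite invgM -mulgA mulKg /= -gpredV invgM invgK.
exact: lrepP.
Qed.

Lemma coset_mulM g h a : coset_mul (g * h) a = coset_mul g (coset_mul h a).
Proof. by rewrite -(coset_of_val a) !coset_mulE mulgA. Qed.

Lemma coset_mulK g : cancel (coset_mul g) (coset_mul g^-1).
Proof. by move=> a; rewrite -coset_mulM mulVg /coset_mul mul1g coset_of_val. Qed.

Lemma coset_mulVK g : cancel (coset_mul g^-1) (coset_mul g).
Proof. by move=> a; rewrite -coset_mulM mulgV /coset_mul mul1g coset_of_val. Qed.

Lemma coset_actM :
  {morph (fun g => Bij (coset_mulK g) (coset_mulVK g)) : g h / g * h}.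
Proof. by move=> g h; apply: bij_eq => a; exact: coset_mulM. Qed.

Definition coset_act : {hom G -> bij coset_type} := mkhom coset_actM.

(** The kernel of the action on cosets is the normal core of [K]. Below, conditions of the form
    [coset_act W x = 1] express membership in such a core. *)
Lemma coset_act_eq1 g : coset_act g = 1 <-> forall x, g ^ x \in K.
Proof.
split=> [g1 x|gK].
  have : coset_mul g (coset_of x) = coset_of x.
    exact: (congr1 (fun f : bij _ => f (coset_of x)) g1).
  rewrite coset_mulE => /coset_of_eq.
  by rewrite -gpredV invgM invgK conjgE.
apply: bij_eq => a; rewrite -(coset_of_val a) [LHS]coset_mulE.
by apply/coset_of_eq; rewrite -gpredV invgM invgK -conjgE.
Qed.

Lemma coset_act_ker g : coset_act g = 1 -> g \in K.
Proof. by move=> /coset_act_eq1/(_ 1); rewrite conjg1. Qed.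

Lemma finite_coset_bij : fin_index K -> finite_type (bij coset_type).
Proof.
move=> [F [r rP]]; apply: finite_type_bij; exists F, (fun a => r (val a)).
by move=> a b /rP/coset_of_eq; rewrite !coset_of_val.
Qed.
End CosetAction.

(** * Derived series and residual properties *)

Section Generated.
Variables (G : groupType) (A : set G).

Lemma mem_generated x : A x -> generated A x. Proof. by move=> Ax K; exact. Qed.

Lemma generated1 : generated A 1. Proof. by move=> K _; exact: gpred1. Qed.

Lemma generatedF x y : generated A x -> generated A y -> generated A (x / y).
Proof. by move=> Ax Ay K AK; apply: gpredF; [exact: Ax | exact: Ay]. Qed.

Lemma generated_sub (B : set G) : B 1 -> (forall x y, B x -> B y -> B (x / y)) ->
  A `<=` B -> generated A `<=` B.
Proof.
move=> B1 BF AB x /(_ (mksub B1 BF)) Bx.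
by apply/(mksubP B1 BF)/Bx => a /AB/(mksubP B1 BF).
Qed.
End Generated.

(** Starting from an arbitrary set allows the derived series of a subgroup to be followed inside the
    ambient group. *)
Fixpoint dseries (G : groupType) (A : set G) (n : nat) : set G :=
  if n is m.+1 then
    generated [set z | exists x y, [/\ dseries A m x, dseries A m y & z = [~ x, y]]]
  else A.

Lemma dseriesT (G : groupType) n : derived_series G n = dseries setT n.
Proof. by elim: n => //= n ->. Qed.

Lemma dseries_add (G : groupType) (A : set G) m n : dseries (dseries A m) n = dseries A (n + m).
Proof. by elim: n => //= n ->. Qed.

Section DseriesMap.
Variables (G H : groupType) (K : groupClosed G) (f : G -> H).
Hypothesis fM : {in K &, {morph f : x y / x * y}}.

Let f1 : f 1 = 1.
Proof. by apply: (@mulgI _ (f 1)); rewrite -fM ?gpred1// !mulg1. Qed.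

Let fV : {in K, {morph f : x / x^-1}}.
Proof.
move=> x xK; apply: (@mulgI _ (f x)).
by rewrite -fM ?gpredV// !mulgV.
Qed.

(** Multiplicativity on [K] suffices. This covers a coordinate of a homomorphism to a wreath
    product, restricted to the kernel of the second component. *)
Lemma dseries_map (A : set G) (B : set H) n : (forall x, A x -> x \in K /\ B (f x)) ->
  forall x, dseries A n x -> x \in K /\ dseries B n (f x).
Proof.
move=> AB; elim: n => //= n IHn.
apply: generated_sub.
- by rewrite gpred1 f1; split=> //; exact: generated1.
- move=> x y [xK fx] [yK fy]; rewrite gpredF//; split=> //.
  by rewrite fM ?gpredV// fV//; exact: generatedF.
move=> _ [x [y [/IHn[xK fx] /IHn[yK fy] ->]]].
rewrite gpredR//; split=> //; apply: mem_generated; exists (f x), (f y); split=> //.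
by rewrite /commg !fM ?(gpredM, gpredV)// !fV.
Qed.
End DseriesMap.

Lemma dseries_hom (G H : groupType) (f : {hom G -> H}) (A : set G) (B : set H) n :
  (forall x, A x -> B (f x)) -> forall x, dseries A n x -> dseries B n (f x).
Proof.
move=> AB x; elim: n x => //= n IHn; apply: generated_sub.
- by rewrite gmulf1; exact: generated1.
- by move=> x y fx fy; rewrite gmulfF; exact: generatedF.
move=> _ [x [y [/IHn fx /IHn fy ->]]].
by apply: mem_generated; exists (f x), (f y); rewrite gmulfR.
Qed.

Lemma dseries_mono (G : groupType) (A B : set G) n : A `<=` B -> dseries A n `<=` dseries B n.
Proof. by move=> AB; exact: (@dseries_hom G G idfun). Qed.

Lemma dseries_image (G H : groupType) (f : {hom G -> H}) (A : set G) n :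
  dseries (f @` A) n `<=` f @` dseries A n.
Proof.
elim: n => //= n IHn; apply: generated_sub.
- by exists 1; [exact: generated1 | exact: gmulf1].
- move=> _ _ [x Ax <-] [y Ay <-].
  by exists (x / y); [exact: generatedF | exact: gmulfF].
move=> _ [_ [_ [/IHn[x Ax <-] /IHn[y Ay <-] ->]]]; rewrite -gmulfR.
by exists [~ x, y] => //; apply: mem_generated; exists x, y.
Qed.

Section DseriesGroup.
Variables (G : groupType) (K : groupClosed G) (n : nat).
Let A : set G := dseries [set x | x \in K] n.

Lemma dseries1 : A 1.
Proof. by rewrite /A; case: n => [|m] /=; [exact: gpred1 | exact: generated1]. Qed.

Lemma dseriesF x y : A x -> A y -> A (x / y).
Proof. by rewrite /A; case: n => [|m] /=; [exact: gpredF | exact: generatedF]. Qed.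

Definition dseries_group : groupClosed G := mksub dseries1 dseriesF.

Lemma dseries_groupP x : x \in dseries_group <-> dseries [set x | x \in K] n x.
Proof. exact: mksubP. Qed.

Lemma dseries_sub x : dseries [set x | x \in K] n x -> x \in K.
Proof. by move=> /(@dseries_map _ _ K id (fun _ _ _ _ => erefl) _ setT n)[]. Qed.

End DseriesGroup.

Section ImageHom.
Variables (G H : groupType) (f : {hom G -> H}).

Let imP x : f x \in group_image f. Proof. by apply/asboolP; exists x. Qed.

Lemma im_homM : {morph (fun x => Subgroup (imP x)) : x y / x * y}.
Proof. by move=> x y; apply: val_inj; rewrite [RHS]gmulfM /= gmulfM. Qed.

Definition im_hom : {hom G -> subgroup (group_image f)} := mkhom im_homM.

Lemma im_homE x : sgval (im_hom x) = f x. Proof. by []. Qed.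

Lemma im_hom_surj y : exists x, im_hom x = y.
Proof. by case: y => y yP; have /asboolP[x fx] := yP; exists x; apply: val_inj. Qed.

Lemma im_hom_eq1 x : im_hom x = 1 -> f x = 1.
Proof. by move=> /(congr1 (@sgval _ _)); rewrite im_homE => ->. Qed.
End ImageHom.

(** Replacing the target by the image makes a homomorphism surjective and keeps the target
    finite. *)
Lemma residually_finiteP (G : groupType) :
  residually_finite G <->
  forall x : G, x <> 1 -> exists (H : groupType) (f : {hom G -> H}),
    finite_type H /\ f x <> 1.
Proof.
split=> resG x /resG[H [f]].
  by move=> [fH _ fx]; exists H, f; split=> //; exact/finite_typeP.
move=> [fH fx]; exists (subgroup (group_image f)), (im_hom f); split.
- apply/finite_typeP; apply: finite_type_inj fH; exact: val_inj.
- exact: im_hom_surj.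
by move/im_hom_eq1.
Qed.

Section SubgroupResidual.
Variables (G : groupType) (K : groupClosed G).

Lemma residually_solvable_dseries : residually_solvable (subgroup K) ->
  forall x, x \in K -> x <> 1 -> exists n, ~ dseries [set x | x \in K] n x.
Proof.
move=> resK x xK xn1.
have [|Q [q [[n Qn] _ qx]]] := resK (Subgroup xK).
  by move=> /(congr1 (@sgval _ _)).
exists n => Kx.
(* [insubd] extends [q] by a default value outside [K]; the extension is still multiplicative on
   [K]. *)
pose f y := q (insubd (1 : subgroup K) y).
have fM : {in K &, {morph f : x y / x * y}}.
  move=> y z yK zK; rewrite /f -gmulfM; congr (q _); apply: val_inj.
  by rewrite [RHS]gmulfM /= !insubdK// gpredM.
have [//|_] := dseries_map fM (B := setT) _ Kx.
rewrite -dseriesT Qn /f => qx1; apply: qx; rewrite -[RHS]qx1; congr (q _).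
by apply: val_inj; rewrite insubdK.
Qed.

(** The required quotient of the subgroup is its image under [f]: the derived series of this image
    lies in the image of the derived series of [K]. *)
Lemma residually_solvable_subgroup :
  (forall x, x \in K -> x <> 1 -> exists (H : groupType) (f : {hom G -> H}) n,
     f x <> 1 /\ forall y, dseries [set y | y \in K] n y -> f y = 1) ->
  residually_solvable (subgroup K).
Proof.
move=> resK x xn1.
have [||H [f [n [fx fn]]]] := resK (sgval x); first exact: sgvalP.
  by move=> x1; apply: xn1; exact: val_inj.
have sM : {morph (@sgval _ K) : x y / x * y} by move=> y z; exact: valM.
pose s := mkhom sM.
pose fs : {hom subgroup K -> H} := f \o s.
exists (subgroup (group_image fs)), (im_hom fs); split.
- exists n; apply/seteqP; split=> [y|_ ->]; last first.
    rewrite dseriesT; case: n {fn} => //= n; exact: generated1.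
  rewrite dseriesT => yn; apply: val_inj.
  have tM : {morph (@sgval _ (group_image fs)) : x y / x * y}.
    by move=> u v; exact: valM.
  have [|z zn] := @dseries_image _ _ f [set y | y \in K] n (sgval y).
    apply: (dseries_hom (f := mkhom tM)) yn => u _.
    have /asboolP[v vu] := sgvalP u.
    by exists (sgval v); [exact: sgvalP | rewrite mkhomE -vu].
  by rewrite fn.
- exact: im_hom_surj.
by move/im_hom_eq1.
Qed.
End SubgroupResidual.

(** * Words in amalgamated products *)

Definition bit : Type := bool.
HB.instance Definition _ := Choice.copy bit bool.
HB.instance Definition _ := @isGroup.Build bit false idfun addb
  addbA addFb addbF addbb addbb.

Lemma bit_mulC (x y : bit) : x * y = y * x. Proof. exact: addbC. Qed.

Section Amalgam.
Variables (G0 G1 G2 G : groupType).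
Variables (i1 : {hom G0 -> G1}) (i2 : {hom G0 -> G2}).
Variables (j1 : {hom G1 -> G}) (j2 : {hom G2 -> G}).
Hypothesis amalgG : is_amalgamated_product i1 i2 j1 j2.

Lemma amalgam_comm z : j1 (i1 z) = j2 (i2 z).
Proof. by have [_ _ + _] := amalgG; apply. Qed.

Lemma amalgam_lift (H : groupType) (f1 : {hom G1 -> H}) (f2 : {hom G2 -> H}) :
  (forall z, f1 (i1 z) = f2 (i2 z)) ->
  exists f : {hom G -> H}, (forall x, f (j1 x) = f1 x) /\
                           (forall x, f (j2 x) = f2 x).
Proof. by have [_ _ _ +] := amalgG => /[apply] -[f [? ? _]]; exists f. Qed.

(** The factors generate the pushout. The elements which, together with their inverses, preserve [S]
    by left multiplication form a subgroup [K] containing both factors; the induced map from [G] to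
    [K], followed by inclusion, is the identity by uniqueness. *)
Lemma amalgam_ind (S : set G) : S 1 ->
  (forall x g, S g -> S (j1 x * g)) -> (forall x g, S g -> S (j2 x * g)) ->
  forall g, S g.
Proof.
move=> S1 S_1 S_2.
pose A := [set g | forall h, (S h -> S (g * h)) /\ (S h -> S (g^-1 * h))].
have A1 : A 1 by move=> h; rewrite invg1 !mul1g.
have AF x y : A x -> A y -> A (x / y).
  move=> Ax Ay h; rewrite invgF -!mulgA.
  by split=> Sh; [apply: (Ax _).1; apply: (Ay _).2
                 |apply: (Ay _).1; apply: (Ax _).2].
pose K := mksub A1 AF.
have K1 x : j1 x \in K by apply/mksubP => h; rewrite -gmulfV; split; exact: S_1.
have K2 x : j2 x \in K by apply/mksubP => h; rewrite -gmulfV; split; exact: S_2.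
have f1M : {morph (fun x => Subgroup (K1 x)) : x y / x * y}.
  by move=> x y; apply: val_inj; rewrite [RHS]valM /= gmulfM.
have f2M : {morph (fun x => Subgroup (K2 x)) : x y / x * y}.
  by move=> x y; apply: val_inj; rewrite [RHS]valM /= gmulfM.
have [|f [f1 f2]] := amalgam_lift (f1 := mkhom f1M) (f2 := mkhom f2M).
  by move=> z; apply: val_inj; exact: amalgam_comm.
have sM : {morph (@sgval _ K) : x y / x * y} by move=> x y; exact: valM.
pose s : {hom G -> G} := mkhom sM \o f.
have [h [_ _ hU]] : exists h : {hom G -> G}, [/\ h \o j1 =1 j1, h \o j2 =1 j2 &
    forall f' : {hom G -> G}, f' \o j1 =1 j1 -> f' \o j2 =1 j2 -> f' =1 h].
  by have [_ _ + +] := amalgG => jE; apply.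
have sE : s =1 h by apply: hU => x /=; rewrite ?f1 ?f2.
have iE : (idfun : {hom G -> G}) =1 h by exact: hU.
move=> g; have := sgvalP (f g).
have -> : sgval (f g) = g by rewrite -[LHS]/(s g) sE -iE.
by move=> /mksubP/(_ 1)[+ _]; rewrite mulg1; apply.
Qed.

(** [b1] and [b2] are crossed homomorphisms over [f]; the universal property glues them once they
    agree on [G0]. *)
Lemma wreath_lift (P H : groupType) (f : {hom G -> H})
    (b1 : G1 -> H -> P) (b2 : G2 -> H -> P) :
  (forall x x' y, b1 (x * x') y = b1 x y * b1 x' ((f (j1 x))^-1 * y)) ->
  (forall x x' y, b2 (x * x') y = b2 x y * b2 x' ((f (j2 x))^-1 * y)) ->
  (forall z y, b1 (i1 z) y = b2 (i2 z) y) ->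
  exists F : {hom G -> wreath P H},
    [/\ forall g, (F g).2 = f g, forall x, (F (j1 x)).1 = b1 x &
        forall x, (F (j2 x)).1 = b2 x].
Proof.
move=> b1M b2M b12.
have f1M : {morph (fun x => (b1 x, f (j1 x)) : wreath P H) : x y / x * y}.
  move=> x x'; congr pair; last by rewrite !gmulfM.
  by apply/funext=> y; rewrite b1M.
have f2M : {morph (fun x => (b2 x, f (j2 x)) : wreath P H) : x y / x * y}.
  move=> x x'; congr pair; last by rewrite !gmulfM.
  by apply/funext=> y; rewrite b2M.
have [|F [F1 F2]] := amalgam_lift (f1 := mkhom f1M) (f2 := mkhom f2M).
  move=> z; rewrite !mkhomE amalgam_comm; congr pair.
  by apply/funext=> y; rewrite b12.
exists F; split=> [|x|x]; rewrite ?F1 ?F2 //.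
by apply: amalgam_ind => [|x g IHg|x g IHg]; rewrite ?gmulf1 // !gmulfM
  wreath_mul2 IHg ?F1 ?F2.
Qed.

Lemma wreath_lift_in (P H : groupType) (F : {hom G -> wreath P H}) (Q : groupClosed P) :
  (forall x y, (F (j1 x)).1 y \in Q) -> (forall x y, (F (j2 x)).1 y \in Q) ->
  forall g y, (F g).1 y \in Q.
Proof.
move=> F1 F2; apply: amalgam_ind => [|x g IHg|x g IHg] y.
- by rewrite gmulf1 gpred1.
- by rewrite gmulfM wreath_mul1 gpredM ?F1 ?IHg.
- by rewrite gmulfM wreath_mul1 gpredM ?F2 ?IHg.
Qed.

Definition edge (g : G) : Prop := exists z, g = j1 (i1 z).

Definition separates (H : groupType) (f : {hom G -> H}) (g : G) : Prop :=
  forall z, f g <> f (j1 (i1 z)).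

Definition factor (t : bool) (g : G) : Prop :=
  if t then exists x, g = j1 x else exists x, g = j2 x.

Definition syllable (s : bool * G) : Prop := factor s.1 s.2 /\ ~ edge s.2.

Definition wprod (w : seq (bool * G)) : G := foldr (fun s g => s.2 * g) 1 w.

Let alt : rel (bool * G) := fun s s' => s.1 != s'.1.

Let sorted_alt t x y w : sorted alt ((t, x) :: w) -> sorted alt ((t, y) :: w).
Proof. by case: w. Qed.

Lemma edgeM g h : edge g -> edge h -> edge (g * h).
Proof. by move=> [x ->] [y ->]; exists (x * y); rewrite !gmulfM. Qed.

Lemma edgeV g : edge g -> edge g^-1.
Proof. by move=> [x ->]; exists x^-1; rewrite !gmulfV. Qed.

Lemma edge_factor t g : edge g -> factor t g.
Proof.
move=> [z ->]; case: t => /=; first by exists (i1 z).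
by exists (i2 z); rewrite amalgam_comm.
Qed.

Lemma factorM t g h : factor t g -> factor t h -> factor t (g * h).
Proof.
case: t => -[x ->] [y ->]; exists (x * y); by rewrite gmulfM.
Qed.

(** Existence of reduced forms is stable under left multiplication by a factor: an edge element is
    absorbed by the next syllable, two syllables of one factor are merged, and if the result is an
    edge element it is absorbed in turn. *)
Lemma reduced_word g : edge g \/ exists w, [/\ w <> [::], sorted alt w,
  forall s, s \in w -> syllable s & wprod w = g].
Proof.
pose S : set G := fun g => edge g \/ exists w, [/\ w <> [::], sorted alt w,
  forall s, s \in w -> syllable s & wprod w = g].
suff SM t x h : factor t x -> S h -> S (x * h).
  apply: (@amalgam_ind S) => [|x h|x h].
  - by left; exists 1; rewrite !gmulf1.
  - by apply: (SM true); exists x.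
  - by apply: (SM false); exists x.
move=> tx Sh; have [ex|nex] := pselect (edge x).
  case: Sh => [eh|[[|[t' x'] w] [// _ aw sw <-]]].
    by left; exact: edgeM.
  right; exists ((t', x * x') :: w); split=> //; [exact: sorted_alt aw| |by rewrite /= mulgA].
  move=> s; rewrite inE => /predU1P[->|sw']; last by apply: sw; rewrite inE sw' orbT.
  have [/= tx' ex'] := sw (t', x') (mem_head _ _).
  split=> /=; first exact/factorM/tx'/edge_factor.
  by move=> exx'; apply: ex'; rewrite -(mulKg x x'); exact/edgeM/exx'/edgeV.
case: Sh => [eh|[[|[t' x'] w] [// _ aw sw <-]]].
  right; exists [:: (t, x * h)]; split=> //; last by rewrite /= mulg1.
  move=> s; rewrite inE => /eqP->; split=> /=; first exact/factorM/edge_factor.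
  by move=> exh; apply: nex; rewrite -(mulgK h x); exact/edgeM/edgeV.
have [tt'|tt'] := eqVneq t t'; last first.
  right; exists ((t, x) :: (t', x') :: w); split=> //.
    by rewrite /= /alt /= tt'.
  by move=> s; rewrite inE => /predU1P[->|/sw].
subst t'; have [/= tx' ex'] := sw (t, x') (mem_head _ _).
have [exx'|nexx'] := pselect (edge (x * x')); last first.
  right; exists ((t, x * x') :: w); split=> //; [exact: sorted_alt aw| |by rewrite /= mulgA].
  move=> s; rewrite inE => /predU1P[->|sw']; last by apply: sw; rewrite inE sw' orbT.
  by split=> //; exact: factorM.
case: w aw sw => [|[t2 x2] w] aw sw; first by left; rewrite /= mulg1.
right; exists ((t2, x * x' * x2) :: w); split=> //.
- by move: aw => /= /andP[_]; case: w {sw}.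
- move=> s; rewrite inE => /predU1P[->|sw']; last first.
    by apply: sw; rewrite !inE sw' !orbT.
  have [|/= tx2 ex2] := sw (t2, x2); first by rewrite !inE eqxx orbT.
  split=> /=; first exact/factorM/tx2/edge_factor.
  move=> e2; apply: ex2; rewrite -(mulKg (x * x') x2).
  exact/edgeM/e2/edgeV.
- by rewrite /= !mulgA.
Qed.

Lemma separates_comp (H H' : groupType) (f : {hom G -> H}) (f' : {hom G -> H'})
    (p : H' -> H) g : (forall g, p (f' g) = f g) -> separates f g -> separates f' g.
Proof. by move=> pf fg z /(congr1 p); rewrite !pf; exact: fg. Qed.

(* The map x |-> (1, f x) on G1 and x |-> (e, 1) (1, f x) (e, 1)^-1 on G2, with
   e the indicator function of f (j1 (i1 G0)): its first component records the
   edges modulo 2 crossed by the path of a word in the graph of the cosets of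
   the images of G1 and G2 in H. *)
Section Step.
Variables (H : groupType) (f : {hom G -> H}).

Let tau : bit := true.

Let e (y : H) : bit := if `[< exists z, y = f (j1 (i1 z)) >] then tau else 1.

Let eM z y : e ((f (j1 (i1 z)))^-1 * y) = e y.
Proof.
rewrite /e; congr (if _ then _ else _); apply: asbool_equiv_eq.
split=> -[z' yE].
  by exists (z * z'); rewrite -[LHS](mulVKg (f (j1 (i1 z)))) yE !gmulfM.
by exists (z^-1 * z'); rewrite yE !gmulfM !gmulfV.
Qed.

Lemma cycle_cover : exists F : {hom G -> wreath bit H},
  (forall g, (F g).2 = f g) /\
  forall w, (forall s, s \in w -> syllable s) -> sorted alt w -> 1 < size w ->
    (forall u, infix u w -> 0 < size u < size w -> separates f (wprod u)) ->
    separates F (wprod w).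
Proof.
have [|||F [F2 Fj1 Fj2]] := @wreath_lift bit H f (fun _ _ => 1)
  (fun x y => e y * (e ((f (j2 x))^-1 * y))^-1).
- by move=> x x' y; rewrite mulg1.
- by move=> x x' y; rewrite !gmulfM invgM !mulgA mulgVK.
- by move=> z y; rewrite -amalgam_comm eM mulgV.
exists F; split=> // w sw aw w2 sepw z.
have F1 x y : factor true x -> (F x).1 y = 1.
  by move=> [x' ->]; rewrite Fj1.
have F0 x y : factor false x -> (F x).1 y = e y * (e ((f x)^-1 * y))^-1.
  by move=> [x' ->]; rewrite Fj2.
have FS s u y : (F (wprod (s :: u))).1 y =
    (F s.2).1 y * (F (wprod u)).1 ((f s.2)^-1 * y).
  by rewrite /= gmulfM wreath_mul1 F2.
have e1 : e 1 = tau by rewrite /e asboolT//; exists 1; rewrite !gmulf1.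
have esep g : separates f g -> e (f g) = 1 /\ e (f g)^-1 = 1.
  move=> sg; rewrite /e !asboolF // => -[z' gE].
    by apply: (sg z'^-1); rewrite !gmulfV -gE invgK.
  exact: (sg z').
(* A word contributes nothing at [y] if the translates of [y] by its prefixes all avoid the support
   of [e]. *)
have Fu u y : (forall s, s \in u -> syllable s) ->
    (forall p, prefix p u -> e ((f (wprod p))^-1 * y) = 1) ->
    (F (wprod u)).1 y = 1.
  elim: u y => [|[t x] u IHu] y su pu; first by rewrite gmulf1.
  rewrite FS IHu; first last.
  - move=> p pp; rewrite mulgA -invgM -gmulfM -[_ * wprod p]/(wprod ((t, x) :: p)).
    by apply: pu; rewrite /= eqxx.
  - by move=> s us; apply: su; rewrite inE us orbT.
  have [/= tx _] := su (t, x) (mem_head _ _).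
  rewrite mulg1; case: t tx su pu => [/F1->//|/F0->] su pu.
  have := pu [::] isT; rewrite /= gmulf1 invg1 mul1g => ->.
  have := pu [:: (false, x)]; rewrite /= eqxx prefix0s mulg1 => -> //.
case: w sw aw w2 sepw => [|[t1 x1] [|[t2 x2] u]]//= sw /andP[t12 aw] _ sepw.
have infw p : prefix p ((t2, x2) :: u) -> infix p [:: (t1, x1), (t2, x2) & u].
  by move=> /prefixW pi; exact: infix_trans pi (infix_cons _ _).
have sx1 : separates f x1.
  rewrite -[x1]mulg1; apply: (sepw [:: (t1, x1)]) => //.
  by rewrite eqxx.
have [tx1 _] := sw (t1, x1) (mem_head _ _).
have [|tx2 _] := sw (t2, x2); first by rewrite !inE eqxx orbT.
have Fw2 : (F (wprod ((t2, x2) :: u))).1 1 = if t2 then 1 else tau.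
  rewrite FS Fu; first last.
  - move=> p pp; rewrite !mulgA mulg1 -invgM -gmulfM.
    rewrite -[_ * wprod p]/(wprod ((t2, x2) :: p)).
    apply: (esep _ _).2; apply: sepw; first by apply: infw; rewrite /= eqxx.
    by rewrite /= ltnS; exact: (size_prefix pp).
  - by move=> s us; apply: sw; rewrite !inE us !orbT.
  rewrite mulg1; case: t2 {t12 aw sw} tx2 sepw infw => [/F1->//|/F0-> sepw infw].
  rewrite e1 mulg1 (esep _ _).2 //= -[x2]mulg1.
  apply: (sepw [:: (false, x2)]) => //.
  by apply: infw; rewrite /= eqxx prefix0s.
(* The coordinate [f x1] marks the passage from the first syllable to the second. Exactly one of the
   two comes from [G2] and contributes [tau], whereas the first component is trivial on [G0]. *)
move=> /(congr1 (fun a : wreath bit H => a.1 (f x1))).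
rewrite Fj1 -[x1 * _]/(wprod [:: (t1, x1), (t2, x2) & u]) FS mulVg Fw2.
case: t1 t2 t12 tx1 {sw aw sepw infw tx2 Fw2} => [] [] // _.
  by move=> /F1->.
by move=> /F0->; rewrite (esep _ sx1).1 mulVg e1.
Qed.

End Step.

(** * Detection of reduced words by a class of homomorphisms closed under products and extensions by
    Z/2 *)

Section Residual.
Variable good : forall H : groupType, {hom G -> H} -> Prop.
Hypothesis good_prod : forall (H H' : groupType) (f : {hom G -> H})
    (f' : {hom G -> H'}) (F : {hom G -> (H * H')%type}),
  (forall g, (F g).1 = f g) -> (forall g, (F g).2 = f' g) ->
  good f -> good f' -> good F.
Hypothesis good_wreath : forall (H : groupType) (f : {hom G -> H})
    (F : {hom G -> wreath bit H}),
  (forall g, (F g).2 = f g) -> good f -> good F.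
Hypothesis good_edge : forall z, z <> 1 ->
  exists (H : groupType) (f : {hom G -> H}), good f /\ f (j1 (i1 z)) <> 1.
Hypothesis good_syllable : forall s, syllable s ->
  exists (H : groupType) (f : {hom G -> H}), good f /\ separates f s.2.

Let good_syllables s0 w : (forall s, s \in s0 :: w -> syllable s) ->
  exists (H : groupType) (f : {hom G -> H}),
    good f /\ forall s, s \in s0 :: w -> separates f s.2.
Proof.
elim: w s0 => [|s1 w IHw] s0 sw.
  have [H [f [fP fs]]] := good_syllable (sw s0 (mem_head _ _)).
  by exists H, f; split=> // s; rewrite inE => /eqP->.
have [|H [f [fP fs]]] := IHw s1.
  by move=> s sw'; apply: sw; rewrite inE sw' orbT.
have [H' [f' [fP' fs']]] := good_syllable (sw s0 (mem_head _ _)).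
have FM : {morph (fun g => (f g, f' g) : (H * H')%type) : x y / x * y}.
  by move=> x y; rewrite !gmulfM.
exists (H * H')%type, (mkhom FM); split; first exact: good_prod fP fP'.
move=> s; rewrite inE => /predU1P[->|/fs].
  exact: (separates_comp (p := snd)).
exact: (separates_comp (p := fst)).
Qed.

(** Induction on [m]: some good homomorphism separates all subwords of length at most [m] from the
    edge group, and each cover raises [m] by one. For [m] the length of the word, separation from
    the trivial edge element is the claim. *)
Lemma good_residual g : g <> 1 ->
  exists (H : groupType) (f : {hom G -> H}), good f /\ f g <> 1.
Proof.
have [[z ->] zn1|[w [wn0 aw sw <-]] _] := reduced_word g.
  by apply: good_edge => z1; apply: zn1; rewrite z1 !gmulf1.
have /(_ (size w))[H [f [fP fw]]] m : exists (H : groupType) (f : {hom G -> H}),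
    good f /\ forall u, infix u w -> 0 < size u <= m -> separates f (wprod u).
  elim: m => [|m [H [f [fP fw]]]].
    case: w wn0 sw {aw} => // s w _ /good_syllables[H [f [fP _]]].
    by exists H, f; split=> // u _; case: size.
  (* Subwords of length one are syllables, separated by hypothesis; the cover applies from length
     two on. *)
  case: m fw => [|m] fw.
    case: w wn0 sw {aw fw} => // s w _ /good_syllables[H' [f' [fP' fs]]].
    exists H', f'; split=> // -[|s' [|]] // + _; rewrite infix1s => /fs.
    by rewrite /= mulg1.
  have [F [F2 sepF]] := cycle_cover f.
  exists (wreath bit H), F; split; first exact: good_wreath fP.
  move=> u uw /andP[u0]; rewrite leq_eqVlt ltnS => /predU1P[um|um]; last first.
    apply: (@separates_comp _ _ f F snd _ F2); apply: fw => //; exact/andP.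
  apply: sepF; last 1 first.
  - move=> v vu /andP[v0]; rewrite um ltnS => vm; apply: fw; rewrite ?v0//.
    exact: infix_trans vu uw.
  - by move=> s /(mem_infix uw)/sw.
  - by have /infixP[p [q wE]] := uw; move: aw; rewrite wE => /cat_sorted2[_] /cat_sorted2[].
  - by rewrite um.
exists H, f; split=> // fw1; apply: (fw w (infix_refl w) _ 1).
  by rewrite leqnn andbT; case: w wn0 {aw sw fw fw1}.
by rewrite !gmulf1.
Qed.
End Residual.
End Amalgam.

(** * Amalgamating permutation and induced representations *)

(** The orbits of the image of [A] under left multiplication are right cosets, so inverses are taken
    to use the representatives of left cosets. [t] is the base point of the orbit and [u] moves it
    to the given point. *)
Lemma orbit_section (A H : groupType) (f : {hom A -> H}) :
  exists (u : H -> A) (t : H -> H),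
    (forall h, f (u h) * t h = h) /\ (forall a h, t (f a * h) = t h).
Proof.
pose t h := (lrep (group_image f) h^-1)^-1.
have /choice[u uP] h : exists a, f a * t h = h.
  have /asboolP[a fa] := lrepP (group_image f) h^-1.
  by exists a; rewrite fa invgK mulgK.
exists u, t; split=> // a h; rewrite /t; congr _^-1; apply: lrep_eq.
rewrite invgK mulgK.
by apply/asboolP; exists a.
Qed.

Section Amalgam.
Variables (G0 G1 G2 G : groupType).
Variables (i1 : {hom G0 -> G1}) (i2 : {hom G0 -> G2}).
Variables (j1 : {hom G1 -> G}) (j2 : {hom G2 -> G}).
Hypothesis amalgG : is_amalgamated_product i1 i2 j1 j2.

Section FiniteAmalgam.
Variables (F1 F2 : groupType) (f1 : {hom G1 -> F1}) (f2 : {hom G2 -> F2}).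
Hypothesis f12 : forall z, f1 (i1 z) = 1 <-> f2 (i2 z) = 1.

Let f12_eq a b : f1 (i1 a) = f1 (i1 b) <-> f2 (i2 a) = f2 (i2 b).
Proof.
have := f12 (a / b); rewrite !gmulfF => fab.
split=> ab; apply: divg1_eq; apply/fab; by rewrite ab mulgV.
Qed.

(* G1 acts on the first factor of F1 * F2 and G2 on the second; G0 acts freely
   modulo the common kernel on both, and swapping the G0-coordinates of the two
   factors intertwines its two actions. *)
Lemma amalgam_perm : exists f : {hom G -> bij (F1 * F2)},
  (forall x, f (j1 x) = 1 <-> f1 x = 1) /\ (forall x, f (j2 x) = 1 <-> f2 x = 1).
Proof.
have [u1 [t1 [u1E t1E]]] := orbit_section (f1 \o i1 : {hom G0 -> F1}).
have [u2 [t2 [u2E t2E]]] := orbit_section (f2 \o i2 : {hom G0 -> F2}).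
rewrite /= in u1E t1E u2E t2E.
have u1M a h : f1 (i1 (u1 (f1 (i1 a) * h))) = f1 (i1 (a * u1 h)).
  apply: (@mulIg _ (t1 h)); rewrite -[in LHS](t1E a) u1E !gmulfM.
  by rewrite -mulgA u1E.
have u2M a h : f2 (i2 (u2 (f2 (i2 a) * h))) = f2 (i2 (a * u2 h)).
  apply: (@mulIg _ (t2 h)); rewrite -[in LHS](t2E a) u2E !gmulfM.
  by rewrite -mulgA u2E.
have t1K h : t1 (t1 h) = t1 h by rewrite -[in RHS](u1E h) t1E.
have t2K h : t2 (t2 h) = t2 h by rewrite -[in RHS](u2E h) t2E.
have u1t h : f1 (i1 (u1 (t1 h))) = 1.
  by apply: (@mulIg _ (t1 h)); rewrite mul1g -{2}(t1K h) u1E.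
have u2t h : f2 (i2 (u2 (t2 h))) = 1.
  by apply: (@mulIg _ (t2 h)); rewrite mul1g -{2}(t2K h) u2E.
pose T (p : F1 * F2) : F1 * F2 :=
  (f1 (i1 (u2 p.2)) * t1 p.1, f2 (i2 (u1 p.1)) * t2 p.2).
have TK : cancel T T.
  move=> [x y]; rewrite /T /= !t1E !t2E t1K t2K; congr pair.
    rewrite -[RHS]u1E; congr (_ * _); apply/f12_eq.
    by rewrite u2M !gmulfM u2t mulg1.
  rewrite -[RHS]u2E; congr (_ * _); apply/f12_eq.
  by rewrite u1M !gmulfM u1t mulg1.
have [tau tauE] : exists tau : bij (F1 * F2), forall p, tau p = T p.
  by exists (Bij TK TK).
have tauK p : tau (tau p) = p by rewrite !tauE TK.
pose a1 (g : F1) : bij (F1 * F2) :=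
  @Bij _ (fun p => (g * p.1, p.2)) (fun p => (g^-1 * p.1, p.2))
  (fun '(x, y) => congr2 pair (mulKg g x) erefl)
  (fun '(x, y) => congr2 pair (mulVKg g x) erefl).
pose a2 (g : F2) : bij (F1 * F2) :=
  @Bij _ (fun p => (p.1, g * p.2)) (fun p => (p.1, g^-1 * p.2))
  (fun '(x, y) => congr2 pair erefl (mulKg g y))
  (fun '(x, y) => congr2 pair erefl (mulVKg g y)).
have h1M : {morph (fun x => a1 (f1 x)) : x y / x * y}.
  by move=> x y; apply: bij_eq => -[p q] /=; rewrite gmulfM mulgA.
(* [tau] is an involution, so this is the action of [G2] conjugated by [tau]. *)
have h2M : {morph (fun x => tau * a2 (f2 x) * tau) : x y / x * y}.
  move=> x y; apply: bij_eq => p.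
  by rewrite !bijM /= !tauK /= gmulfM mulgA.
have [|f [fj1 fj2]] := amalgam_lift amalgG (f1 := mkhom h1M) (f2 := mkhom h2M).
  move=> z; apply: bij_eq => -[x y].
  rewrite !bijM !tauE /= /T /= !t1E !t2E t1K t2K; congr pair.
    rewrite -[in LHS](u1E x) mulgA -gmulfM -gmulfM; congr (_ * _); apply/f12_eq.
    by rewrite !(gmulfM, u2M) u2t mulg1.
  rewrite -[LHS]u2E; congr (_ * _); apply/f12_eq.
  by rewrite u1M !gmulfM u1t mulg1.
exists f; split=> x; rewrite ?fj1 ?fj2 mkhomE; split=> [fx|->].
- by have /(congr1 fst) := congr1 (fun h : bij _ => h (1, 1)) fx; rewrite /= mulg1.
- by apply: bij_eq => -[p q] /=; rewrite mul1g.
- have := congr1 (fun h : bij _ => tau (h (tau (1, 1)))) fx.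
  by rewrite !bijM /= !tauK /= => /(congr1 snd); rewrite /= mulg1.
- by apply: bij_eq => p; rewrite !bijM /= mul1g -surjective_pairing tauK.
Qed.
End FiniteAmalgam.

Section Twist.
Variables (H : groupType) (f : {hom G -> H}).

(** The section [s] for the orbits of [A] refines the section [u] for those of [G0]: [v] leads from
    the base point of the [A]-orbit to that of the [G0]-orbit, and [u] leads on from there.
    Translation by [G0] thus changes only the factor [u]. *)
Let factor_section (A : groupType) (i : {hom G0 -> A}) (j : {hom A -> G})
    (u : H -> G0) (t : H -> H) :
  (forall y, f (j (i (u y))) * t y = y) ->
  (forall z y, t (f (j (i z)) * y) = t y) ->
  exists s v : H -> A,
    [/\ forall g y, f (j ((s y)^-1 * g * s ((f (j g))^-1 * y))) = 1,
        forall z y, v (f (j (i z)) * y) = v y &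
        forall y, s y = i (u y) * v y].
Proof.
move=> uE tE; have [v [r [vE rE]]] := orbit_section (f \o j : {hom A -> H}).
rewrite /= in vE rE.
exists (fun y => i (u y) * v (t y)), (v \o t); split=> [g y|z y|//]; last by rewrite /= tE.
have sE h : f (j (i (u h) * v (t h))) = h / r h.
  apply: (@mulIg _ (r h)); rewrite mulgVK.
  rewrite -[in r h](uE h) rE -[RHS]uE -[in RHS](vE (t h)).
  by rewrite !gmulfM mulgA.
have jE a b c : f (j (a^-1 * b * c)) = (f (j a))^-1 * f (j b) * f (j c).
  by rewrite !gmulfM !gmulfV.
rewrite jE !sE; set y' := _^-1 * y.
have -> : r y = r y' by rewrite -(rE g y') /y' mulVKg.
by rewrite invgF /y' !mulgA mulgK mulgVK mulgV.
Qed.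

Section Lift.
Variables (P : groupType) (k1 d1 : G1 -> P) (k2 d2 : G2 -> P) (l : G0 -> P).
Hypothesis k1M : forall x y, f (j1 x) = 1 -> f (j1 y) = 1 -> k1 (x * y) = k1 x * k1 y.
Hypothesis k2M : forall x y, f (j2 x) = 1 -> f (j2 y) = 1 -> k2 (x * y) = k2 x * k2 y.
Hypothesis k1l : forall z x, f (j1 (i1 z)) = 1 -> d1 x * k1 (i1 z ^ x) / d1 x = l z.
Hypothesis k2l : forall z x, f (j2 (i2 z)) = 1 -> d2 x * k2 (i2 z ^ x) / d2 x = l z.

(* The twisted product d (k (s^-1 g s)) d^-1 is the representation induced from
   the kernel of f, written in a basis in which G0 only sees l. *)
Lemma induced_lift : exists F : {hom G -> wreath P H},
  [/\ forall g, (F g).2 = f g,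
      exists c, forall z, f (j1 (i1 z)) = 1 -> (F (j1 (i1 z))).1 1 = l (z ^ c),
      exists c e, forall x, f (j1 x) = 1 ->
        (F (j1 x)).1 1 = d1 e * k1 (x ^ c) / d1 e &
      forall Q : groupClosed P,
        (forall x a b, f (j1 x) = 1 -> d1 a * k1 x / d1 b \in Q) ->
        (forall x a b, f (j2 x) = 1 -> d2 a * k2 x / d2 b \in Q) ->
        forall g y, (F g).1 y \in Q].
Proof.
have [u [t [uE tE]]] := orbit_section (f \o j1 \o i1 : {hom G0 -> H}).
rewrite /= in uE tE.
have [s1 [v1 [s1K v1E s1E]]] := factor_section uE tE.
have jE z : j1 (i1 z) = j2 (i2 z) := amalgam_comm amalgG z.
have [||s2 [v2 [s2K v2E s2E]]] := @factor_section _ i2 j2 u t.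
- by move=> y; rewrite -jE.
- by move=> z y; rewrite -jE.
pose b1 x y := d1 (v1 y) * k1 ((s1 y)^-1 * x * s1 ((f (j1 x))^-1 * y)) /
  d1 (v1 ((f (j1 x))^-1 * y)).
pose b2 x y := d2 (v2 y) * k2 ((s2 y)^-1 * x * s2 ((f (j2 x))^-1 * y)) /
  d2 (v2 ((f (j2 x))^-1 * y)).
(* The cocycle of [G0] for its own section [u]. Both [b1] and [b2] restrict to [l (w z y)]: the
   sections differ from [u] by a factor constant on [G0]-orbits, whose effect [k1l] and [k2l]
   remove. *)
pose w z y := (u y)^-1 * z * u ((f (j1 (i1 z)))^-1 * y).
have fV z y : (f (j1 (i1 z)))^-1 * y = f (j1 (i1 z^-1)) * y by rewrite !gmulfV.
have jE3 a b c : f (j1 (i1 (a^-1 * b * c))) =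
    (f (j1 (i1 a)))^-1 * f (j1 (i1 b)) * f (j1 (i1 c)).
  by rewrite !gmulfM !gmulfV.
have uE' y : f (j1 (i1 (u y))) = y / t y.
  by apply: (@mulIg _ (t y)); rewrite mulgVK uE.
have wK z y : f (j1 (i1 (w z y))) = 1.
  rewrite jE3 !uE' fV tE -fV invgF !mulgA mulgK.
  by rewrite mulgVK mulgV.
have b1E z y : b1 (i1 z) y = l (w z y).
  rewrite -(k1l (v1 y) (wK z y)) /b1 fV v1E -fV; congr (_ * k1 _ * _).
  rewrite !s1E fV v1E -fV conjgE /w.
  by rewrite invgM !gmulfM !gmulfV !mulgA.
have b2E z y : b2 (i2 z) y = l (w z y).
  have wK2 : f (j2 (i2 (w z y))) = 1 by rewrite -jE wK.
  rewrite -(k2l (v2 y) wK2) /b2 -jE fV jE v2E -jE -fV; congr (_ * k2 _ * _).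
  rewrite !s2E fV jE v2E -jE -fV conjgE /w.
  by rewrite invgM !gmulfM !gmulfV !mulgA.
have [|||F [F2 F1 F1']] := wreath_lift amalgG (f := f) (b1 := b1) (b2 := b2).
- move=> x x' y; rewrite /b1 !gmulfM invgM -[_^-1 * _^-1 * y]mulgA.
  set y' := (f (j1 x))^-1 * y; set y'' := _^-1 * y'.
  rewrite !mulgA mulgVK; congr (_ / _); rewrite -[RHS]mulgA -k1M ?s1K//; congr (_ * k1 _).
  by rewrite !mulgA mulgK.
- move=> x x' y; rewrite /b2 !gmulfM invgM -[_^-1 * _^-1 * y]mulgA.
  set y' := (f (j2 x))^-1 * y; set y'' := _^-1 * y'.
  rewrite !mulgA mulgVK; congr (_ / _); rewrite -[RHS]mulgA -k2M ?s2K//; congr (_ * k2 _).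
  by rewrite !mulgA mulgK.
- by move=> z y; rewrite b1E b2E.
exists F; split=> //.
- exists (u 1) => z fz; rewrite F1 b1E /w fz invg1 mul1g.
  by rewrite conjgE mulgA.
- exists (s1 1), (v1 1) => x fx; rewrite F1 /b1 fx invg1 mul1g.
  by rewrite conjgE mulgA.
move=> Q Q1 Q2; apply: (wreath_lift_in amalgG) => x y.
  by rewrite F1; exact/Q1/s1K.
by rewrite F1'; exact/Q2/s2K.
Qed.
End Lift.
End Twist.
End Amalgam.

(** * Homomorphisms from the integers *)

Section GcdFamily.
Variables (T : Type) (c : T -> nat) (x0 : T).
Hypothesis c0 : 0 < c x0.

(** [d] is the largest common divisor, bounded by [c x0]. After cancelling the gcd of [k] and [j],
    the remaining part [k'] of [k] is coprime to that of [j], so [d * k'] is again a common divisor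
    and [k'] is 1. *)
Lemma gcd_family : exists d, [/\ 0 < d, forall x, d %| c x &
  forall k j, (forall x, d * k %| j * c x)%N -> k %| j].
Proof.
pose p n := `[< forall x, n %| c x >].
have p1 : exists n, p n by exists 1%N; apply/asboolP => x; exact: dvd1n.
have pmax n : p n -> n <= c x0 by move=> /asboolP/(_ x0); exact: dvdn_leq.
case: (ex_maxnP p1 pmax) => d /asboolP pd dmax.
have d0 : 0 < d by apply: (@dvdn_gt0 _ (c x0)).
exists d; split=> // k j dkj.
have [->|j0] := posnP j; first exact: dvdn0.
have [k0|k0] := posnP k.
  by have := dkj x0; rewrite k0 muln0 dvd0n muln_eq0; lia.
have g0 : 0 < gcdn k j by rewrite gcdn_gt0 k0.
have [k' kE] := dvdnP (dvdn_gcdl k j).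
have [j' jE] := dvdnP (dvdn_gcdr k j).
have k'0 : 0 < k' by move: k0; rewrite {1}kE muln_gt0 => /andP[].
have cop : coprime k' j'.
  rewrite /coprime -(eqn_pmul2r g0) mul1n muln_gcdl -kE -jE //.
have : d * k' <= d.
  apply: dmax; apply/asboolP => x.
  have [q cE] := dvdnP (pd x); rewrite cE mulnC dvdn_pmul2r//.
  rewrite -(Gauss_dvdr q cop) -(dvdn_pmul2r d0) -(dvdn_pmul2r g0).
  move: (dkj x); rewrite cE; move: (gcdn k j) kE jE => g -> ->.
  have -> : (d * (k' * g) = k' * d * g)%N by lia.
  by have -> : (j' * g * (q * d) = j' * q * d * g)%N by lia.
rewrite -{2}[d]muln1 leq_pmul2l// => k'1.
have k'E : k' = 1%N by apply/eqP; rewrite eqn_leq k'1.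
by rewrite kE k'E mul1n dvdn_gcdr.
Qed.
End GcdFamily.

Section IntHom.
Variable (A : groupType).

Definition int_hom (h : int -> A) : Prop := forall m n, h (m + n)%R = h m * h n.

Variable h : int -> A.
Hypothesis hM : int_hom h.

Lemma int_hom0 : h 0%R = 1.
Proof. by apply: (@mulgI _ (h 0%R)); rewrite -hM addr0 mulg1. Qed.

Lemma int_homN m : h (- m)%R = (h m)^-1.
Proof. by apply: (@mulgI _ (h m)); rewrite -hM subrr int_hom0 mulgV. Qed.

Lemma int_hom_mulV m n : h m = h n -> h (n - m)%R = 1.
Proof. by move=> hmn; rewrite hM int_homN hmn mulgV. Qed.
End IntHom.

Lemma int_hom_eq (A : groupType) (h h' : int -> A) :
  int_hom h -> int_hom h' -> h 1%R = h' 1%R -> h =1 h'.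
Proof.
move=> hM h'M h1; elim/int_ind => [|n IHn|n IHn].
- by rewrite !int_hom0.
- by rewrite -addn1 PoszD hM h'M IHn h1.
- by rewrite -addn1 PoszD opprD hM h'M IHn !(int_homN hM) !(int_homN h'M) h1.
Qed.

Definition int_pow (A : groupType) (g : A) (m : int) : A :=
  match m with Posz n => g ^+ n | Negz n => g ^- n.+1 end.

Lemma int_pow_hom (A : groupType) (g : A) : int_hom (int_pow g).
Proof.
have hS m : int_pow g (m + 1)%R = int_pow g m * g.
  case: m => [n|[|n]].
  - by rewrite -PoszD addn1 /= expgSr.
  - by rewrite /= mulVg.
  - have -> : (Negz n.+1 + 1 = Negz n)%R by lia.
    by rewrite /= [g ^+ n.+2]expgS invgM mulgVK.
move=> m; elim/int_ind => [|n IHn|n IHn].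
- by rewrite addr0 mulg1.
- by rewrite -addn1 PoszD addrA !hS IHn mulgA.
- apply: (@mulIg _ g); rewrite -hS -mulgA -hS.
  have -> : (- n.+1%:Z + 1 = - n%:Z)%R by lia.
  by rewrite -IHn; congr int_pow; lia.
Qed.

(** The cyclic subgroup is infinite or trivial; the second alternative covers finite groups. *)
Definition faithful_or_trivial (A : groupType) (e : int -> A) : Prop :=
  injective e \/ forall m, e m = 1.

(** As [e] may fail to be injective, a logarithm is chosen once for each value of [e], and [r] is
    its residue modulo [M]. *)
Lemma int_range_fin (A : groupType) (e : int -> A) : int_hom e ->
  forall M : nat, 0 < M -> exists r : A -> 'I_M, forall m n, r (e m) = r (e n) ->
    exists q, (e m)^-1 * e n = e (M%:Z * q)%R.
Proof.
move=> eM M M0.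
have /choice[l lP] x : exists m, (exists n, x = e n) -> x = e m.
  have [[n xE]|nx] := pselect (exists n, x = e n); first by exists n.
  by exists 0%R => /nx.
have lt x : (`|(l x %% M%:Z)%Z|%N < M)%N.
  have := ltz_pmod (l x) (ltac:(lia) : (0 < M%:Z)%R).
  have := modz_ge0 (l x) (ltac:(lia) : (M%:Z != 0)%R); lia.
exists (fun x => Ordinal (lt x)) => m n [] /= mn.
rewrite (lP (e m)); last by exists m.
rewrite (lP (e n)); last by exists n.
rewrite -int_homN// -eM; exists ((l (e n) %/ M%:Z)%Z - (l (e m) %/ M%:Z)%Z)%R.
congr e; rewrite {1}(divz_eq (l (e m)) M%:Z) {1}(divz_eq (l (e n)) M%:Z).
have := modz_ge0 (l (e m)) (ltac:(lia) : (M%:Z != 0)%R).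
have := modz_ge0 (l (e n)) (ltac:(lia) : (M%:Z != 0)%R).
lia.
Qed.

(** If the generator has infinite order, [e] is its power map. Otherwise the trivial subgroup has
    finite index too, and [e] is constant. *)
Lemma virtually_cyclic_int (A : groupType) : virtually_cyclic A ->
  exists e : int -> A, [/\ int_hom e, faithful_or_trivial e &
    exists (F : finType) (r : A -> F), forall x y, r x = r y ->
      exists m, x^-1 * y = e m].
Proof.
move=> [K [[g gK] /finite_indexP[F [r rP]]]].
have KE x : x \in K -> exists m, x = int_pow g m.
  move=> /gK[n [->|->]]; first by exists n.
  by exists (- n%:Z)%R; rewrite (int_homN (int_pow_hom g)).
have [[n n0 gn]|ng] := pselect (exists2 n, 0 < n & g ^+ n = 1); last first.
  exists (int_pow g); split; first exact: int_pow_hom.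
    left=> m m' mm'; have := int_hom_mulV (int_pow_hom g) mm'.
    case dE: (m' - m)%R => [[|d]|d] gd.
    - lia.
    - by case: ng; exists d.+1.
    - case: ng; exists d.+1 => //.
      by apply: invg_inj; rewrite invg1.
  by exists F, r => x y /rP/KE.
exists (fun=> 1); split; [by move=> *; rewrite mulg1|by right|].
(* Exponents congruent modulo [n] give the same power of [g], so [r'] separates the elements of
   [K]. *)
have [r' r'P] := int_range_fin (int_pow_hom g) n0.
have fK : fin_index K by exists F, r.
have e1A : (1 : A) = 1 := erefl.
have eF (x y : A) : x = 1 -> y = 1 -> x / y = 1 by move=> -> ->; rewrite mulgV.
have [|F' [r'' r''P]] := @fin_index_trans _ K (mksub e1A eF) _ r' fK.
  move=> x y /KE[m ->] /KE[m' ->] /r'P[q ->]; apply/mksubP.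
  have nM : int_hom (fun q => int_pow g (n%:Z * q)%R).
    by move=> a b; rewrite mulrDr int_pow_hom.
  rewrite (int_hom_eq nM (h' := fun=> 1)) //; first by move=> *; rewrite mulg1.
  by rewrite mulr1.
by exists F', r'' => x y /r''P/mksubP ->; exists 0%R.
Qed.

Section Retract.
Variables (A0 A : groupType) (i : {hom A0 -> A}).

(** The retraction is a total map with values in [A0] itself, multiplicative on [K] only, so that no
    subgroup types occur. *)
Definition retraction (K : groupClosed A) (rho : A -> A0) : Prop :=
  [/\ fin_index K, forall z, i z \in K,
      {in K &, {morph rho : x y / x * y}} & forall z, rho (i z) = z].

Lemma virtual_retractP : injective i -> virtual_retract (group_image i) ->
  exists K rho, retraction K rho.
Proof.
move=> iI [K [/finite_indexP fK iK [rho rhoE]]].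
have iK' z : i z \in K by apply: iK; apply/asboolP; exists z.
have /choice[p pP] x : exists z, i z = sgval (rho (insubd (1 : subgroup K) x)).
  by have /asboolP := sgvalP (rho (insubd (1 : subgroup K) x)).
exists K, p; split=> // [x y xK yK|z]; apply: iI.
  rewrite gmulfM !pP -[RHS]valM -gmulfM; congr (sgval (rho _)).
  by apply: val_inj; rewrite valM !insubdK// gpredM.
rewrite pP rhoE /=; first by rewrite -[LHS]/(val _) insubdK.
rewrite -[sgval _]/(val _) insubdK//; by apply/asboolP; exists z.
Qed.
End Retract.

(** * Kernels with prescribed trace on a virtual retract *)

(* If e is constant then no m qualifies, and the default 0 of xget is the
   intended logarithm. *)
Definition int_log (A : groupType) (e : int -> A) (b : nat) (z : A) : int :=
  xget 0%R [set m | injective e /\ z = e (b%:Z * m)%R].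

Section IntLog.
Variables (A : groupType) (e : int -> A).
Hypothesis e_or : faithful_or_trivial e.

Lemma int_log_inj (b : nat) m : injective e -> 0 < b ->
  int_log e b (e (b%:Z * m)%R) = m.
Proof.
move=> eI b0; rewrite /int_log; case: xgetP => [n _ [_ /eI bmn]|/(_ m)/= []//].
by apply/esym/(mulfI _ bmn); lia.
Qed.

Lemma int_log_triv b z : (forall m, e m = 1) -> int_log e b z = 0%R.
Proof.
move=> e1; rewrite /int_log; case: xgetP => // n _ [eI _].
by have := eI 0%R 1%R; rewrite !e1 => /(_ erefl).
Qed.

Lemma int_log_eq0 (b : nat) m : int_hom e -> 0 < b ->
  int_log e b (e (b%:Z * m)%R) = 0%R -> e (b%:Z * m)%R = 1.
Proof.
move=> eM b0; case: e_or => [eI|->//].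
by rewrite int_log_inj// => ->; rewrite mulr0 int_hom0.
Qed.
End IntLog.

Section Kernel.
Variables (A0 A : groupType) (i : {hom A0 -> A}).
Variables (K : groupClosed A) (rho : A -> A0) (e : int -> A0).
Hypothesis rhoK : retraction i K rho.
Hypothesis eM : int_hom e.
Hypothesis e_or : faithful_or_trivial e.
Hypothesis e_fin : exists (F : finType) (r : A0 -> F), forall x y, r x = r y ->
  exists m, x^-1 * y = e m.

Let iK z : i z \in K. Proof. by have [] := rhoK. Qed.
Let rhoM : {in K &, {morph rho : x y / x * y}}. Proof. by have [] := rhoK. Qed.
Let rhoi z : rho (i z) = z. Proof. by have [] := rhoK. Qed.

Let rho1 : rho 1 = 1. Proof. by rewrite -[RHS]rhoi gmulf1. Qed.

Let rhoV : {in K, {morph rho : x / x^-1}}.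
Proof.
move=> x xK; apply: (@mulgI _ (rho x)).
by rewrite -rhoM ?gpredV// !mulgV.
Qed.

Let rhoF : {in K &, {morph rho : x y / x / y}}.
Proof. by move=> x y xK yK; rewrite rhoM ?gpredV// rhoV. Qed.

Lemma level_subproof (U : groupClosed A) (M : nat) :
  let S := [set x | [/\ x \in U, x \in K & exists m, rho x = e (M%:Z * m)%R]] in
  S 1 /\ forall x y, S x -> S y -> S (x / y).
Proof.
split=> [|x y [xU xK [m rx]] [yU yK [n ry]]].
  by split; rewrite ?gpred1//; exists 0%R; rewrite mulr0 int_hom0.
split; rewrite ?gpredF//; exists (m - n)%R.
by rewrite rhoF// rx ry mulrBr eM int_homN.
Qed.

Definition level (U : groupClosed A) (M : nat) : groupClosed A :=
  mksub (level_subproof U M).1 (level_subproof U M).2.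

Lemma levelP U M x : x \in level U M <->
  [/\ x \in U, x \in K & exists m, rho x = e (M%:Z * m)%R].
Proof. exact: mksubP. Qed.

Lemma level_fin U M : fin_index U -> 0 < M -> fin_index (level U M).
Proof.
move=> [F1 [r1 r1P]] M0; have [F2 [r2 r2P]] := e_fin.
have fK : fin_index K by have [] := rhoK.
have [r3 r3P] := int_range_fin eM M0.
have fl1 : fin_index (level U 1).
  apply: (fin_index_trans (r := fun x => (r1 x, r2 (rho x))) fK).
  move=> x y xK yK [/r1P xyU /r2P[m xym]]; apply/levelP; split=> //.
    by rewrite gpredM ?gpredV.
  by exists m; rewrite mul1r rhoM ?gpredV// rhoV.
apply: (fin_index_trans (r := fun x => r3 (rho x)) fl1).
move=> x y /levelP[xU xK [m rx]] /levelP[yU yK [n ry]].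
rewrite rx ry => /r3P[q qE]; apply/levelP; split; rewrite ?gpredM ?gpredV//.
by exists q; rewrite rhoM ?gpredV// rhoV// rx ry qE.
Qed.

Lemma level_sub U M x : x \in level U M -> x \in level U 1.
Proof.
move=> /levelP[xU xK [m rx]]; apply/levelP; split=> //.
by exists (M%:Z * m)%R; rewrite mul1r.
Qed.

(** [a] depends on [U] but not on [k], so two factors can be given equal traces by taking for [k]
    the constant of the other one. [a] is the order of the image of [e 1] in the action on the
    cosets of [level U 1]. *)
Lemma controlled_kernel (U : groupClosed A) : fin_index U ->
  exists2 a, 0 < a & forall k, 0 < k -> exists W : groupClosed A,
    [/\ fin_index W, forall x, x \in W -> x \in U,
        forall x, x \in W -> x \in K /\ exists m, rho x = e m &
        forall z, coset_act W (i z) = 1 <-> exists m, z = e ((a * k)%:Z * m)%R].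
Proof.
move=> fU.
have WU M x : x \in level U M -> x \in U by move=> /levelP[].
have WK M x : x \in level U M -> x \in K /\ exists m, rho x = e m.
  by move=> /levelP[_ xK [m rx]]; split=> //; exists (M%:Z * m)%R.
case: e_or => [eI|e1]; last first.
  exists 1%N => // k k0; exists (level U 1).
  split; [exact: level_fin|exact: WU|exact: WK|move=> z; split].
    by move=> /coset_act_ker/WK[_ [m]]; rewrite rhoi => ->; exists 0%R; rewrite !e1.
  by move=> [m ->]; rewrite e1 !gmulf1.
pose N m := coset_act (level U 1) (i (e m)).
have NM : int_hom N by move=> m n; rewrite /N eM !gmulfM.
(* Pigeonhole: there are finitely many permutations of the cosets, so two powers of the image of
   [e 1] agree. *)
have exN : exists n, `[< N (n.+1%:Z)%R = 1 >].
  have [F [g gI]] := finite_coset_bij (level_fin fU (isT : 0 < 1)).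
  have /injectivePn[m [n mn]] : ~~ injectiveb (fun m : 'I_#|F|.+1 => g (N (m%:Z)%R)).
    apply/negP => /injectiveP/leq_card.
    by rewrite card_ord ltnn.
  wlog mn' : m n mn / m < n.
    move=> wl; have [mn'|nm|mn'] := ltngtP m n.
    - exact: wl mn mn'.
    - by rewrite eq_sym in mn => /esym; exact: wl mn nm.
    - by move: mn; rewrite (val_inj mn') eqxx.
  move=> /gI/(int_hom_mulV NM) Nmn; exists (n - m).-1; apply/asboolP.
  by rewrite -Nmn; congr N; lia.
case: (ex_minnP exN) => a' /asboolP Na amin.
set a := a'.+1 in Na; exists a => // k k0.
have Nmul m q : N m = 1 -> N (m * q)%R = 1.
  move=> Nm; have hM : int_hom (fun q => N (m * q)%R).
    by move=> x y; rewrite mulrDr NM.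
  rewrite (int_hom_eq hM (h' := fun=> 1)) //; first by move=> *; rewrite mulg1.
  by rewrite mulr1.
have Ndvd m : N m = 1 -> exists q, m = (a%:Z * q)%R.
  move=> Nm; exists (m %/ a%:Z)%Z; rewrite mulrC.
  have Nr : N (m %% a%:Z)%Z = 1.
    have -> : (m %% a%:Z)%Z = (m + a%:Z * - (m %/ a%:Z)%Z)%R.
      by rewrite {2}(divz_eq m a); lia.
    by rewrite NM Nm mul1g Nmul.
  have r0 := modz_ge0 m (isT : (a%:Z != 0)%R).
  have ra := ltz_pmod m (isT : (0 < a%:Z)%R).
  rewrite {1}(divz_eq m a).
  case rE: (m %% a)%Z Nr r0 ra => [[|r]|r] // Nr _ ra; first by rewrite addr0.
  have := amin r (introT (asboolP _) Nr); lia.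
have NW m x : N m = 1 -> i (e m) ^ x \in level U 1.
  by move=> /coset_act_eq1.
have NK m x : i (e (a%:Z * m)%R) ^ x \in K.
  by have /WK[] := NW _ x (Nmul _ m Na).
have /choice[c cP] x : exists m, rho (i (e (a%:Z)%R) ^ x) = e m.
  by have /WK[_] := NW _ x Na.
have rhoc x m : rho (i (e (a%:Z * m)%R) ^ x) = e (m * c x)%R.
  have hM : int_hom (fun m => e (a%:Z * m)%R).
    by move=> p q; rewrite mulrDr eM.
  have h1 : int_hom (fun m => rho (i (e (a%:Z * m)%R) ^ x)).
    by move=> p q; rewrite hM gmulfM conjMg rhoM ?NK.
  have h2 : int_hom (fun m => e (m * c x)%R).
    by move=> p q; rewrite mulrDl eM.
  by apply: (int_hom_eq h1 h2); rewrite mulr1 mul1r cP.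
(* Conjugation by 1 changes nothing and [rho] is a retraction, so [c 1] is [a]. *)
have c1 : 0 < absz (c 1).
  have := cP 1; rewrite conjg1 rhoi => /eI <-; lia.
(* With d the gcd of the logarithms c x of the conjugates of e a, the subgroup
   of level d * k meets the image of A0 exactly in the powers of e (a * k). *)
have [d [d0 dc dk]] := gcd_family (c := fun x => `|c x|%N) c1.
have dk0 : 0 < d * k by rewrite muln_gt0 d0.
exists (level U (d * k)); split; [exact: level_fin|exact: WU|exact: WK|move=> z; split].
  move=> /coset_act_eq1 zW.
  have [_ _ [n]] := (levelP _ _ _).1 (zW 1); rewrite conjg1 rhoi => zE.
  have [|q qE] := Ndvd ((d * k)%:Z * n)%R.
    by apply/coset_act_eq1 => x; rewrite -zE; exact/level_sub/zW.
  (* Every conjugate of [i z] has logarithm [q * c x], a multiple of [d * k]; the choice of [d]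
     gives the divisibility of [q]. *)
  have kq : k %| `|q|%N.
    apply: dk => x; have /levelP[_ _ [m]] := zW x.
    rewrite zE qE rhoc => /eI qc; rewrite -abszM qc abszM.
    exact: dvdn_mulr.
  have /dvdzP[q' q'E] : (k %| q)%Z by [].
  by exists q'; rewrite zE qE q'E; congr e; lia.
move=> [m ->]; apply/coset_act_eq1 => x; apply/levelP.
have -> : ((a * k)%:Z * m = a%:Z * (k%:Z * m))%R by lia.
have /levelP[zU zK _] := NW _ x (Nmul _ (k%:Z * m)%R Na).
split=> //; rewrite rhoc.
have /dvdzP[q qE] : (d %| c x)%Z by exact: dc.
by exists (m * q)%R; rewrite qE; congr e; lia.
Qed.

(* The coefficients of phi run over the conjugates of the logarithm of rho, so
   that no conjugate of i (e b) can be killed by phi. *)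
Lemma conj_functional (W : groupClosed A) (b : nat) : fin_index W -> 0 < b ->
  (forall x, x \in W -> x \in K /\ exists m, rho x = e m) ->
  (forall z, coset_act W (i z) = 1 <-> exists m, z = e (b%:Z * m)%R) ->
  exists phi : A -> {poly int},
    (forall x y, coset_act W x = 1 -> coset_act W y = 1 ->
       phi (x * y) = (phi x + phi y)%R) /\
    forall v, exists2 d, (d != 0)%R & forall z, coset_act W (i z) = 1 ->
      phi (i z ^ v) = (d *~ int_log e b z)%R.
Proof.
move=> [F [r rP]] b0 WK Wz; case: e_or => [eI|e1]; last first.
  exists (fun=> 0%R); split=> [*|v]; first by rewrite addr0.
  by exists 1%R => [|z _]; rewrite ?oner_neq0// int_log_triv.
pose lg x := int_log e 1 (rho x).
have lgE m x : rho x = e m -> lg x = m.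
  by move=> rx; rewrite /lg rx -[m in e m]mul1r int_log_inj.
have lgM x y : x \in W -> y \in W -> lg (x * y) = (lg x + lg y)%R.
  move=> /WK[xK [m xE]] /WK[yK [n yE]]; rewrite (lgE m x)// (lgE n y)//.
  by apply: lgE; rewrite rhoM// xE yE eM.
have lgJ x w : x \in W -> w \in W -> lg (x ^ w) = lg x.
  move=> /WK[xK [m xE]] /WK[wK [n wE]]; rewrite (lgE m x)//; apply: lgE.
  by rewrite conjgE !rhoM ?gpredM ?gpredV// rhoV// xE wE -int_homN// -!eM; congr e; lia.
(* Coset representatives indexed by the codes of cosets, with 1 at codes that do not occur. *)
have /choice[rep repP] (q : nat) : exists a, forall x,
    enum_rank (r x) = q :> nat -> a^-1 * x \in W.
  have [[a aq]|na] := pselect (exists a, enum_rank (r a) = q :> nat).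
    by exists a => x xq; apply/rP/enum_rank_inj/val_inj; rewrite /= aq xq.
  by exists 1 => x xq; case: na; exists x.
have kerW x a : coset_act W x = 1 -> x ^ a \in W.
  by move=> /coset_act_eq1.
exists (fun x => \poly_(q < #|F|) lg (x ^ rep q)%g)%R; split=> [x y xW yW|v].
  apply/polyP => q; rewrite coefD !coef_poly; case: ifP => // _.
  by rewrite conjMg lgM ?kerW.
have bW : coset_act W (i (e (b%:Z)%R)) = 1.
  by apply/Wz; exists 1%R; rewrite mulr1.
eexists (\poly_(q < #|F|) lg ((i (e (b%:Z)%R) ^ v) ^ rep q)%g)%R.
  (* At the coset of [v^-1], the product [v * rep q] lies in [W]. Conjugation by [W] preserves [lg],
     since [rho] maps [W] into the abelian range of [e], so this coefficient is [b]. *)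
  set q := nat_of_ord (enum_rank (r v^-1)).
  have wW : v * rep q \in W.
    by rewrite -gpredV invgM; exact: (repP q).
  apply/eqP => /polyP/(_ q); rewrite coef_poly coef0 ltn_ord -conjgM.
  rewrite lgJ ?(coset_act_ker bW)//.
  by rewrite (lgE (b%:Z)%R) ?rhoi//; lia.
move=> z /Wz[m ->]; rewrite int_log_inj//; apply/polyP => q.
rewrite coefMrz !coef_poly; case: ifP => _; last by rewrite mul0rz.
rewrite -!conjgM; set x := v * rep q.
rewrite mulrzz; apply: (lgE).
have hM : int_hom (fun m => e (b%:Z * m)%R).
  by move=> p p'; rewrite mulrDr eM.
have hW p : i (e (b%:Z * p)%R) ^ x \in W by apply: kerW; apply/Wz; exists p.
have h1 : int_hom (fun m => rho (i (e (b%:Z * m)%R) ^ x)).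
  by move=> p p'; rewrite hM gmulfM conjMg rhoM ?(WK _ (hW _)).1.
have h2 : int_hom (fun m => e (lg (i (e (b%:Z)%R) ^ x)%g * m)%R).
  by move=> p p'; rewrite mulrDr eM.
apply: (int_hom_eq h1 h2); rewrite !mulr1.
have [|_ [n nE]] := WK (i (e (b%:Z)%R) ^ x); first by have := hW 1%R; rewrite mulr1.
by rewrite (lgE _ _ nE).
Qed.
End Kernel.

(** * Finite quotients *)

Section Affine.
Variable F : fieldType.

Definition translation (a : F) : bij F :=
  @Bij F (fun x => x + a)%R (fun x => x - a)%R (fun x => addrK a x) (fun x => subrK a x).

Lemma translationD a b : translation (a + b)%R = translation a * translation b.
Proof. by apply: bij_eq => x /=; rewrite [(a + b)%R]addrC addrA. Qed.

Lemma translation_eq1 a : translation a = 1 -> a = 0%R.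
Proof. by move=> /(congr1 (fun f : bij F => f 0%R)) /=; rewrite add0r. Qed.

Definition div_bij (d : F) (d0 : (d != 0)%R) : bij F :=
  @Bij F (fun x => x / d)%R (fun x => x * d)%R
    (fun x => divfK d0 x) (fun x => mulfK d0 x).

Definition is_affine : set (bij F) :=
  [set g | exists a b, (a != 0)%R /\ forall x, g x = (a * x + b)%R].

Lemma affine1 : is_affine 1.
Proof. by exists 1%R, 0%R; split=> [|x]; rewrite ?oner_neq0// mul1r addr0. Qed.

Lemma affineV_fun (g : bij F) a b : (a != 0)%R -> (forall x, g x = a * x + b)%R ->
  forall x, bijv g x = (a^-1 * x - a^-1 * b)%R.
Proof.
move=> a0 gE x; rewrite -[x in RHS](bijvK g) gE mulrDr addrK mulrA mulVf// mul1r.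
by [].
Qed.

Lemma affineF g h : is_affine g -> is_affine h -> is_affine (g / h).
Proof.
move=> [a [b [a0 gE]]] [c [d [c0 hE]]]; exists (a / c)%R, (b - a / c * d)%R.
split=> [|x]; first by rewrite mulf_neq0// invr_eq0.
rewrite bijM bijV gE (affineV_fun c0 hE) mulrBr !mulrA -!addrA; congr (_ + _)%R.
by rewrite addrC.
Qed.

Definition affine : groupClosed (bij F) := mksub affine1 affineF.

Lemma div_bij_affine c d t (c0 : (c != 0)%R) (d0 : (d != 0)%R) :
  div_bij c0 * translation t / div_bij d0 \in affine.
Proof.
apply/mksubP; exists (d / c)%R, (t / c)%R; split=> [|x].
  by rewrite mulf_neq0// invr_eq0.
by rewrite !bijM bijV /= mulrDl [(d / c * x)%R]mulrC mulrA.
Qed.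

(** Linear parts commute, so commutators of affine maps are translations, and translations
    commute. *)
Lemma affine_solvable g : dseries [set g | g \in affine] 2 g -> g = 1.
Proof.
have T1 : dseries [set g | g \in affine] 1 `<=` range translation.
  apply: generated_sub.
  - by exists 0%R => //; apply: bij_eq => x /=; rewrite addr0.
  - move=> _ _ [a _ <-] [b _ <-]; exists (a - b)%R => //.
    by apply: bij_eq => x /=; rewrite addrA addrAC.
  move=> _ [x [y [/mksubP[a [b [a0 xE]]] /mksubP[c [d [c0 yE]]] ->]]].
  exists ([~ x, y] 0)%R => //; apply: bij_eq => z.
  rewrite /= !(affineV_fun a0 xE) !(affineV_fun c0 yE) !xE !yE.
  by field; rewrite a0 c0.
apply: (@generated_sub _ _ [set 1]) => //.
  by move=> _ _ -> ->; rewrite mulgV.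
move=> _ [x [y [/T1[a _ <-] /T1[b _ <-] ->]]].
by apply/eqP/commgP; rewrite /commute -!translationD addrC.
Qed.
End Affine.

(** If [x] is outside [K], then [K] serves as [U]. Otherwise let [q] detect [y], the quotient of [x]
    by its retraction, and let [U] be the part of [K] where [q] kills both [w] and [i (rho w)]: if
    [x] were in [i z * U], then [x] and [i (rho x)] would have equal images under [q]. *)
Lemma retract_separable (A0 A : groupType) (i : {hom A0 -> A}) (K : groupClosed A)
    (rho : A -> A0) : retraction i K rho -> residually_finite A ->
  forall x, (forall z, x <> i z) ->
    exists2 U : groupClosed A, fin_index U & forall z, (i z)^-1 * x \notin U.
Proof.
move=> [fK iK rhoM rhoi] /residually_finiteP rfA x xi.
have [xK|xK] := boolP (x \in K); last first.
  by exists K => // z; rewrite gpredMl ?gpredV.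
pose y := (i (rho x))^-1 * x.
have [|Q [q [fQ qy]]] := rfA y.
  by move=> y1; apply: (xi (rho x)); rewrite -[LHS](mulVKg (i (rho x))) -/y y1 mulg1.
have irhoF v w : v \in K -> w \in K -> i (rho (v / w)) = i (rho v) / i (rho w).
  move=> vK wK; apply: (@mulIg _ (i (rho w))).
  by rewrite mulgVK -gmulfM -rhoM ?gpredF// mulgVK.
pose S := [set w | [/\ w \in K, q w = 1 & q (i (rho w)) = 1]].
have S1 : S 1 by split; rewrite ?gpred1 ?gmulf1// -[1](gmulf1 (s := i)) rhoi !gmulf1.
have SF v w : S v -> S w -> S (v / w).
  move=> [vK qv iv] [wK qw iw]; split; first exact: gpredF.
    by rewrite gmulfF qv qw mulgV.
  by rewrite irhoF// gmulfF iv iw mulgV.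
have [F [g gI]] := fQ.
exists (mksub S1 SF) => [|z].
  apply: (fin_index_trans (r := fun w => (g (q w), g (q (i (rho w))))) fK).
  move=> v w vK wK [/gI vw /gI ivw]; apply/mksubP; split.
  - by rewrite gpredM ?gpredV.
  - by rewrite gmulfM gmulfV vw mulVg.
  - rewrite rhoM ?gpredV// !gmulfM -ivw.
    have -> : i (rho v^-1) = (i (rho v))^-1.
      have := irhoF 1 v; rewrite !div1g => -> //; last exact: gpred1.
      by rewrite -[1](gmulf1 (s := i)) rhoi gmulf1 div1g.
    by rewrite gmulfV mulVg.
apply/negP => /mksubP[_ + +]; rewrite rhoM ?gpredV// -gmulfV rhoi !gmulfM => qzx qzr.
apply: qy; rewrite /y gmulfM gmulfV.
have -> : q x = q (i (rho x)) by apply: (@mulgI _ (q (i z^-1))); rewrite qzx qzr.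
by rewrite mulVg.
Qed.

Section FiniteBase.
Variables (G0 G1 G2 G : groupType).
Variables (i1 : {hom G0 -> G1}) (i2 : {hom G0 -> G2}).
Variables (j1 : {hom G1 -> G}) (j2 : {hom G2 -> G}).
Hypothesis amalgG : is_amalgamated_product i1 i2 j1 j2.
Variables (e : int -> G0) (K1 : groupClosed G1) (K2 : groupClosed G2).
Variables (rho1 : G1 -> G0) (rho2 : G2 -> G0).
Hypothesis rho1K : retraction i1 K1 rho1.
Hypothesis rho2K : retraction i2 K2 rho2.
Hypothesis eM : int_hom e.
Hypothesis e_or : faithful_or_trivial e.
Hypothesis e_fin : exists (F : finType) (r : G0 -> F), forall x y, r x = r y ->
  exists m, x^-1 * y = e m.

(** Crossing the constants, [k = a2] in [G1] and [k = a1] in [G2], gives both cores the trace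
    generated by [e (a1 * a2)], as the gluing of permutation actions requires. *)
Lemma finite_base (U1 : groupClosed G1) (U2 : groupClosed G2) :
  fin_index U1 -> fin_index U2 ->
  exists (b : nat) (W1 : groupClosed G1) (W2 : groupClosed G2) (H : groupType)
      (f : {hom G -> H}),
    [/\ 0 < b,
       finite_type H,
       [/\ fin_index W1, forall x, x \in W1 -> x \in U1,
           forall x, x \in W1 -> x \in K1 /\ exists m, rho1 x = e m &
           forall z, coset_act W1 (i1 z) = 1 <-> exists m, z = e (b%:Z * m)%R],
       [/\ fin_index W2, forall x, x \in W2 -> x \in U2,
           forall x, x \in W2 -> x \in K2 /\ exists m, rho2 x = e m &
           forall z, coset_act W2 (i2 z) = 1 <-> exists m, z = e (b%:Z * m)%R] &
       (forall x, f (j1 x) = 1 <-> coset_act W1 x = 1) /\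
       (forall x, f (j2 x) = 1 <-> coset_act W2 x = 1)].
Proof.
move=> fU1 fU2.
have [a1 a10 aW1] := controlled_kernel rho1K eM e_or e_fin fU1.
have [a2 a20 aW2] := controlled_kernel rho2K eM e_or e_fin fU2.
have [W1 W1P] := aW1 a2 a20; have [W2] := aW2 a1 a10.
rewrite mulnC => W2P.
have [|f [f1 f2]] := amalgam_perm amalgG (f1 := coset_act W1) (f2 := coset_act W2).
  move=> z; have [_ _ _ z1] := W1P; have [_ _ _ z2] := W2P.
  exact: (iff_trans (z1 z) (iff_sym (z2 z))).
exists (a1 * a2)%N, W1, W2, (bij (bij (coset_type W1) * bij (coset_type W2))), f.
split=> //; first by rewrite muln_gt0 a10.
apply: finite_type_bij; apply: finite_type_prod.
  by apply: finite_coset_bij; have [] := W1P.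
by apply: finite_coset_bij; have [] := W2P.
Qed.

Lemma amalgam_sep_finite : residually_finite G1 -> forall x, (forall z, x <> i1 z) ->
  exists (H : groupType) (f : {hom G -> H}),
    finite_type H /\ separates i1 j1 f (j1 x).
Proof.
move=> rf1 x /(retract_separable rho1K rf1)[U fU xU].
(* The whole group: no condition is imposed on the second factor. *)
have fT : @fin_index G2 (mksub (A := setT) I (fun _ _ _ _ => I)).
  by exists unit, (fun=> tt) => ? ? _; exact/mksubP.
have [b [W1 [W2 [H [f [_ fH [_ W1U _ _] _ [f1 _]]]]]]] := finite_base fU fT.
exists H, f; split=> // z fxz; have /negP := xU z; apply.
apply: W1U; apply: coset_act_ker; apply/f1.
by rewrite !gmulfM !gmulfV fxz mulVg.
Qed.

Lemma amalgam_edge_finite : injective i1 -> residually_finite G1 ->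
  forall z, z <> 1 -> exists (H : groupType) (f : {hom G -> H}),
    finite_type H /\ f (j1 (i1 z)) <> 1.
Proof.
move=> i1I /residually_finiteP rf1 z zn1.
have [|Q [q [fQ qz]]] := rf1 (i1 z).
  by move=> iz1; apply: zn1; apply: i1I; rewrite iz1 gmulf1.
have q1 : q 1 = 1 := gmulf1.
have qF x y : q x = 1 -> q y = 1 -> q (x / y) = 1.
  by move=> qx qy; rewrite gmulfF qx qy mulgV.
have fU : fin_index (mksub (A := [set x | q x = 1]) q1 qF).
  by apply: (fin_index_ker (f := q) fQ) => x qx; exact/mksubP.
have fT : @fin_index G2 (mksub (A := setT) I (fun _ _ _ _ => I)).
  by exists unit, (fun=> tt) => ? ? _; exact/mksubP.
have [b [W1 [W2 [H [f [_ fH [_ W1U _ _] _ [f1 _]]]]]]] := finite_base fU fT.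
exists H, f; split=> // /f1/coset_act_ker/W1U/mksubP; exact: qz.
Qed.
End FiniteBase.

Lemma is_amalgamated_product_sym (G0 G1 G2 G : groupType)
    (i1 : {hom G0 -> G1}) (i2 : {hom G0 -> G2})
    (j1 : {hom G1 -> G}) (j2 : {hom G2 -> G}) :
  is_amalgamated_product i1 i2 j1 j2 -> is_amalgamated_product i2 i1 j2 j1.
Proof.
move=> [i1I i2I ij univ]; split=> // H f1 f2 f12.
have [//|f [fj1 fj2 fU]] := univ H f2 f1.
by exists f; split=> // f' f'2 f'1; exact: fU.
Qed.

(** * Solvable quotients *)

Section SolvableOn.
Variables (G : groupType) (N : set G).

(** For a subgroup [N] this says that the image of [N] is solvable, while [f] remains defined on all
    of [G]. *)
Definition solvable_on (H : groupType) (f : {hom G -> H}) : Prop :=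
  exists n, forall x, dseries N n x -> f x = 1.

Lemma solvable_on_prod (H H' : groupType) (f : {hom G -> H})
    (f' : {hom G -> H'}) (F : {hom G -> (H * H')%type}) :
  N 1 -> (forall x y, N x -> N y -> N (x / y)) ->
  (forall g, (F g).1 = f g) -> (forall g, (F g).2 = f' g) ->
  solvable_on f -> solvable_on f' -> solvable_on F.
Proof.
move=> N1 NF F1 F2 [n fn] [n' fn'].
have sub m m' : dseries N (m + m') `<=` dseries N m'.
  rewrite -dseries_add => x.
  have R1 : dseries N m' 1 by case: m' => [|k] //; exact: generated1.
  have RF y z : dseries N m' y -> dseries N m' z -> dseries N m' (y / z).
    by case: m' {R1} => [|k]; [exact: NF | exact: generatedF].
  move=> xm; apply/(mksubP R1 RF); apply: (@dseries_sub _ _ m).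
  by apply: dseries_mono xm => y /(mksubP R1 RF).
exists (n + n')%N => x xn; rewrite [F x]surjective_pairing F1 F2.
congr pair; last exact/fn'/sub/xn.
by apply/fn/(sub n'); rewrite addnC.
Qed.

(** After [m] derived steps [f] is trivial; there every coordinate of [F] is multiplicative with
    values in [Q], and [n] further steps kill it. *)
Lemma solvable_on_wreath (P H : groupType) (f : {hom G -> H})
    (F : {hom G -> wreath P H}) (Q : set P) n :
  (forall g, (F g).2 = f g) -> (forall g y, Q ((F g).1 y)) ->
  (forall p, dseries Q n p -> p = 1) -> solvable_on f -> solvable_on F.
Proof.
move=> F2 FQ Qn [m fm]; exists (n + m)%N => x; rewrite -dseries_add => xn.
have k1 : f 1 = 1 := gmulf1.
have kF a b : f a = 1 -> f b = 1 -> f (a / b) = 1.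
  by move=> fa fb; rewrite gmulfF fa fb mulgV.
pose K := mksub (A := [set x | f x = 1]) k1 kF.
have F1 y : (x \in K) /\ dseries Q n ((F x).1 y).
  apply: (dseries_map (K := K) (f := fun x => (F x).1 y)) xn.
    move=> a b /mksubP/= fa _.
    by rewrite gmulfM wreath_mul1 F2 fa invg1 mul1g.
  by move=> a /fm fa; split; [exact/mksubP | exact: FQ].
rewrite [F x]surjective_pairing F2; congr pair.
  by apply/funext=> y; apply: Qn; have [] := F1 y.
by have [/mksubP] := F1 1.
Qed.

Lemma solvable_on_bit (H : groupType) (f : {hom G -> H})
    (F : {hom G -> wreath bit H}) :
  (forall g, (F g).2 = f g) -> solvable_on f -> solvable_on F.
Proof.
move=> F2; apply: (solvable_on_wreath (Q := setT) (n := 1) F2) => //.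
apply: (@generated_sub _ _ [set 1]) => //.
  by move=> _ _ -> ->; rewrite mulgV.
by move=> _ [x [y [_ _ ->]]]; apply/eqP/commgP; exact: bit_mulC.
Qed.
End SolvableOn.

Section Amalgam.
Variables (G0 G1 G2 G : groupType).
Variables (i1 : {hom G0 -> G1}) (i2 : {hom G0 -> G2}).
Variables (j1 : {hom G1 -> G}) (j2 : {hom G2 -> G}).
Hypothesis amalgG : is_amalgamated_product i1 i2 j1 j2.

(** If [f] identifies [x] with some edge element, their quotient [y] lies in the kernel, hence in
    [R], and outside some derived term of [R]. Inducing the action on the cosets of that term
    detects [y]. *)
Lemma amalgam_sep_solvable (N : set G) (R : groupClosed G1)
    (H : groupType) (f : {hom G -> H}) :
  solvable_on N f -> (forall z, f (j1 (i1 z)) = 1 -> z = 1) ->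
  (forall x, f (j1 x) = 1 -> x \in R) -> residually_solvable (subgroup R) ->
  forall x, (forall z, x <> i1 z) ->
    exists (H' : groupType) (f' : {hom G -> H'}),
      solvable_on N f' /\ separates i1 j1 f' (j1 x).
Proof.
move=> fN f0 fR resR x xi.
have [[z xz]|nxz] := pselect (exists z, f (j1 x) = f (j1 (i1 z))); last first.
  by exists H, f; split=> // z xz; apply: nxz; exists z.
pose y := (i1 z)^-1 * x.
have fy : f (j1 y) = 1 by rewrite !gmulfM !gmulfV xz mulVg.
have yn1 : y <> 1.
  by move=> y1; apply: (xi z); rewrite -[LHS](mulVKg (i1 z)) -/y y1 mulg1.
have [n yn] := residually_solvable_dseries resR (fR _ fy) yn1.
pose psi := coset_act (dseries_group R n).
(* The representation is trivial on the [G2] side; compatibility holds because [f] is injective on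
   [G0]. *)
have [||||F [F2 _ [c [d F1]] FQ]] := @induced_lift _ _ _ _ _ _ _ _ amalgG H f
  (bij (coset_type (dseries_group R n))) psi (fun=> 1) (fun=> 1) (fun=> 1) (fun=> 1).
- by move=> a b _ _; rewrite gmulfM.
- by move=> *; rewrite mulg1.
- by move=> a b /f0->; rewrite gmulf1 conj1g gmulf1 /= !mulg1 ?invg1.
- by move=> *; rewrite /= !mulg1 ?invg1.
have S1 : [set p | exists2 a, f (j1 a) = 1 & psi a = p] 1.
  by exists 1; rewrite !gmulf1.
have SF p q : [set p | exists2 a, f (j1 a) = 1 & psi a = p] p ->
    [set p | exists2 a, f (j1 a) = 1 & psi a = p] q ->
    [set p | exists2 a, f (j1 a) = 1 & psi a = p] (p / q).
  move=> [a fa <-] [b fb <-]; exists (a / b); last by rewrite gmulfF.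
  by rewrite !gmulfF fa fb mulgV.
pose Q := mksub S1 SF.
exists (wreath (bij (coset_type (dseries_group R n))) H), F; split.
  apply: (solvable_on_wreath (Q := [set q | q \in Q]) (n := n) F2) => //.
    move=> g h; apply: FQ => [a p q fa|a p q _].
      by apply/mksubP; exists a; rewrite ?invg1 ?mulg1 ?mul1g.
    by rewrite !mulg1 ?invg1 gpred1.
  have -> : [set q | q \in Q] = psi @` [set a | f (j1 a) = 1].
    by apply/seteqP; split=> p => [/mksubP|pS]; [exact | exact/mksubP].
  (* The kernel of [f] in [G1] is normal and contained in [R], so all conjugates of its [n]-th
     derived term lie in that of [R], and [psi] kills this term. *)
  move=> _ /dseries_image[a an <-]; apply/coset_act_eq1 => w; apply/dseries_groupP.
  have cM : {morph (fun a : G1 => a ^ w) : a b / a * b} by move=> ? ?; exact: conjMg.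
  apply: (dseries_hom (f := mkhom cM)) an => b fb; apply: fR.
  by rewrite mkhomE conjgE !gmulfM fb mul1g !gmulfV mulVg.
move=> z' Fz.
(* Injectivity of [f] on [G0] leaves [z] as the only edge element that [F] could identify with [x];
   then [F] would kill [y]. *)
have fz : z = z'.
  apply: divg1_eq; apply: f0; rewrite !gmulfF -xz -F2 Fz F2.
  by rewrite mulgV.
have : (F (j1 y)).1 1 = 1.
  by rewrite /y !gmulfM Fz -fz !gmulfV mulVg.
rewrite F1// mul1g invg1 mulg1 => /coset_act_eq1/(_ c^-1).
by rewrite conjgK => /dseries_groupP.
Qed.
End Amalgam.

Lemma mulrz_tofrac (p : {poly int}) (m : int) :
  (tofrac (p *~ m) = tofrac p * tofrac m%:~R)%R.
Proof. by rewrite -tofracM mulrzr. Qed.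

Section Base.
Variables (G0 G1 G2 G : groupType).
Variables (i1 : {hom G0 -> G1}) (i2 : {hom G0 -> G2}).
Variables (j1 : {hom G1 -> G}) (j2 : {hom G2 -> G}).
Hypothesis amalgG : is_amalgamated_product i1 i2 j1 j2.
Variables (e : int -> G0) (K1 : groupClosed G1) (K2 : groupClosed G2).
Variables (rho1 : G1 -> G0) (rho2 : G2 -> G0).
Hypothesis rho1K : retraction i1 K1 rho1.
Hypothesis rho2K : retraction i2 K2 rho2.
Hypothesis eM : int_hom e.
Hypothesis e_or : faithful_or_trivial e.
Hypothesis e_fin : exists (F : finType) (r : G0 -> F), forall x y, r x = r y ->
  exists m, x^-1 * y = e m.

(** The functionals take polynomial values; in the fraction field the nonzero ones are invertible,
    so coordinates can be rescaled by them. *)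
Let k := {fraction {poly int}}.

Lemma solvable_base (U1 : groupClosed G1) (U2 : groupClosed G2) :
  fin_index U1 -> fin_index U2 ->
  exists (H0 : groupType) (f0 : {hom G -> H0}) (H : groupType) (F : {hom G -> H}),
    [/\ finite_type H0, solvable_on [set g | f0 g = 1] F,
        forall z, F (j1 (i1 z)) = 1 -> z = 1,
        forall x, F (j1 x) = 1 -> x \in U1 &
        forall x, F (j2 x) = 1 -> x \in U2].
Proof.
move=> fU1 fU2.
have [b [W1 [W2 [H0 [f0 [b0 fH0 [fW1 WU1 WK1 Wz1] [fW2 WU2 WK2 Wz2] [f01 f02]]]]]]] :=
  finite_base amalgG rho1K rho2K eM e_or e_fin fU1 fU2.
have [phi1 [phi1M phi1d]] := conj_functional rho1K eM e_or fW1 b0 WK1 Wz1.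
have [phi2 [phi2M phi2d]] := conj_functional rho2K eM e_or fW2 b0 WK2 Wz2.
have /choice[d1 d1P] v : exists d : {poly int}, (tofrac d != 0)%R /\
    forall z, coset_act W1 (i1 z) = 1 -> phi1 (i1 z ^ v) = (d *~ int_log e b z)%R.
  by have [d dn0 dP] := phi1d v; exists d; rewrite tofrac_eq0.
have /choice[d2 d2P] v : exists d : {poly int}, (tofrac d != 0)%R /\
    forall z, coset_act W2 (i2 z) = 1 -> phi2 (i2 z ^ v) = (d *~ int_log e b z)%R.
  by have [d dn0 dP] := phi2d v; exists d; rewrite tofrac_eq0.
pose l z : bij k := translation (tofrac (int_log e b z)%:~R)%R.
(* Rescaling by [d] turns translation by [d *~ m] into translation by [m], whatever the conjugate
   and the factor. *)
have divE (d : {poly int}) (m : int) (d0 : (tofrac d != 0)%R) :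
    div_bij d0 * translation (tofrac (d *~ m)%R) / div_bij d0 =
    translation (tofrac m%:~R)%R.
  apply: bij_eq => x; rewrite !bijM bijV /= mulrz_tofrac mulrDl mulfK//.
  by rewrite mulrAC mulfV// mul1r.
have [||||F [F2 [c Fc] _ FQ]] := @induced_lift _ _ _ _ _ _ _ _ amalgG H0 f0 (bij k)
  (fun x => translation (tofrac (phi1 x))) (fun v => div_bij (d1P v).1)
  (fun x => translation (tofrac (phi2 x))) (fun v => div_bij (d2P v).1) l.
- by move=> x y /f01 x1 /f01 y1; rewrite phi1M// tofracD translationD.
- by move=> x y /f02 x1 /f02 y1; rewrite phi2M// tofracD translationD.
- by move=> z x /f01 z1; rewrite (d1P x).2// divE.
- by move=> z x /f02 z1; rewrite (d2P x).2// divE.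
exists H0, f0, (wreath (bij k) H0), F; split=> //.
- apply: (solvable_on_wreath (Q := [set g | g \in affine k]) (n := 2) F2).
  + by move=> g y; apply: FQ => x u v _; exact: div_bij_affine.
  + exact: affine_solvable.
  + by exists 0%N.
- move=> z Fz.
  (* As [f0] kills [z], its conjugate by [c] is some [e (b * m)], acting on coordinate 1 as
     translation by its logarithm. Integers embed in [k], so the logarithm is zero. *)
  have fz : f0 (j1 (i1 z)) = 1 by rewrite -F2 Fz.
  have lz : l (z ^ c) = 1 by rewrite -Fc// Fz.
  have /f01/Wz1[m mE] : f0 (j1 (i1 (z ^ c))) = 1.
    by rewrite conjgE !gmulfM !gmulfV fz mul1g mulVg.
  apply/eqP; rewrite -(conjg_eq1 z c) mE; apply/eqP.
  apply: int_log_eq0 => //; rewrite -mE.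
  move/translation_eq1/eqP: lz; rewrite tofrac_eq0 -(rmorph_int (@polyC _)) polyC_eq0 intr_eq0 => /eqP.
  by [].
- move=> x Fx; apply: WU1; apply: coset_act_ker; apply/f01.
  by rewrite -F2 Fx.
- move=> x Fx; apply: WU2; apply: coset_act_ker; apply/f02.
  by rewrite -F2 Fx.
Qed.
End Base.

(** * Residual finiteness and virtual residual solvability of the amalgamated product *)

Theorem corollary1p5 (G0 G1 G2 G : groupType)
    (i1 : {hom G0 -> G1}) (i2 : {hom G0 -> G2})
    (j1 : {hom G1 -> G}) (j2 : {hom G2 -> G})
    (amalgG : is_amalgamated_product i1 i2 j1 j2)
    (vcG0 : virtually_cyclic G0)
    (vr1 : virtual_retract (group_image i1))
    (vr2 : virtual_retract (group_image i2)) :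
  (residually_finite G1 -> residually_finite G2 -> residually_finite G) /\
  (virtually_residually_solvable G1 -> virtually_residually_solvable G2 ->
   virtually_residually_solvable G).
Proof.
have [i1I i2I _ _] := amalgG.
have amalgG' := is_amalgamated_product_sym amalgG.
have ij z : j1 (i1 z) = j2 (i2 z) := amalgam_comm amalgG z.
have [K1 [rho1 rho1K]] := virtual_retractP i1I vr1.
have [K2 [rho2 rho2K]] := virtual_retractP i2I vr2.
have [e [eM e_or e_fin]] := virtually_cyclic_int vcG0.
have nedge1 x : ~ edge i1 j1 (j1 x) -> forall z, x <> i1 z.
  by move=> xE z xz; apply: xE; exists z; rewrite xz.
have nedge2 x : ~ edge i1 j1 (j2 x) -> forall z, x <> i2 z.
  by move=> xE z xz; apply: xE; exists z; rewrite xz ij.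
have sep2 (H : groupType) (f : {hom G -> H}) x :
    separates i2 j2 f x -> separates i1 j1 f x.
  by move=> fx z; rewrite ij; exact: fx.
split=> [rf1 rf2|[R1 [/finite_indexP fR1 rsR1]] [R2 [/finite_indexP fR2 rsR2]]].
  apply/residually_finiteP => g.
  apply: (good_residual amalgG (good := fun H _ => finite_type H)).
  - by move=> H H' _ _ _ _ _; exact: finite_type_prod.
  - move=> H _ _ _ fH; apply: finite_type_wreath => //.
    exact: (finite_type_fin bool).
  - exact: (amalgam_edge_finite amalgG rho1K rho2K).
  move=> [[] g' [/= [x ->]]].
    by move=> /nedge1; exact: (amalgam_sep_finite amalgG rho1K rho2K).
  (* Syllables from [G2] are treated by exchanging the factors. *)
  move=> /nedge2 /(amalgam_sep_finite amalgG' rho2K rho1K eM e_or e_fin rf2).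
  by move=> [H [f [fH /sep2 fx]]]; exists H, f.
have [H0 [f0 [H [F [fH0 Fsol FI FU1 FU2]]]]] :=
  solvable_base amalgG rho1K rho2K eM e_or e_fin fR1 fR2.
have k1 : f0 1 = 1 := gmulf1.
have kF x y : f0 x = 1 -> f0 y = 1 -> f0 (x / y) = 1.
  by move=> fx fy; rewrite gmulfF fx fy mulgV.
pose N := mksub (A := [set g | f0 g = 1]) k1 kF.
(* [N] is the kernel of a map to a finite group. The detecting homomorphisms are defined on [G],
   with solvability asked on [N] only. *)
exists N; split.
  apply/finite_indexP; apply: (fin_index_ker (f := f0) fH0) => x fx; exact/mksubP.
apply: residually_solvable_subgroup => g _.
have -> : [set y | y \in N] = [set g | f0 g = 1].
  by apply/seteqP; split=> p => [/mksubP|pS]; [exact | exact/mksubP].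
suff gr : g <> 1 -> exists (H : groupType) (f : {hom G -> H}),
    solvable_on [set g | f0 g = 1] f /\ f g <> 1.
  by move=> /gr[H' [f [[n fn] fg]]]; exists H', f, n.
apply: (good_residual amalgG (good := @solvable_on G [set g | f0 g = 1])).
- by move=> *; apply: solvable_on_prod; eassumption.
- by move=> *; apply: solvable_on_bit; eassumption.
- by move=> z zn1; exists H, F; split=> // /FI.
move=> [[] g' [/= [x ->]]].
  by move=> /nedge1; exact: (amalgam_sep_solvable amalgG Fsol FI FU1 rsR1).
move=> /nedge2; have FI' z : F (j2 (i2 z)) = 1 -> z = 1 by rewrite -ij; exact: FI.
move=> /(amalgam_sep_solvable amalgG' Fsol FI' FU2 rsR2).
by move=> [H' [f [fH /sep2 fx]]]; exists H', f.
Qed.
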